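(* Let $G$ be a connected planar graph on $n$ vertices. If $k\ge 12\sqrt{n}$, then $\mathrm{capt}_k(G)\le 6\,\mathrm{rad}(G)\log n$.
   Context: Graphs are finite, undirected and reflexive. The game of Cops and Robbers: cops choose starting vertices (round 0), then the robber; players alternate, cops (any subset) moving to adjacent vertices or staying put, then the robber moving or staying; cops win by occupying the robber's vertex. For $k$ at least the cop number, $\mathrm{capt}_k(G)$ is the minimum over $k$-cop strategies of the number of rounds (excluding round 0) until capture against an optimally evading robber. $\mathrm{rad}(G)$ is the radius of $G$; $\log$ is the natural logarithm. *)

(* Defs.v *)
From mathcomp Require Import all_boot all_order all_algebra.
From mathcomp Require Import all_classical all_reals all_analysis.
Import Order.TTheory GRing.Theory Num.Theory.
Import numFieldNormedType.Exports.

Set Implicit Arguments.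
Unset Strict Implicit.
Unset Printing Implicit Defensive.

Local Open Scope classical_set_scope.
Local Open Scope ring_scope.

(* A graph on the finite vertex type T is a relation e : rel T, assumed
   symmetric and reflexive: the loops e x x encode the option of staying put. *)

Definition connected_graph (T : finType) (e : rel T) : Prop :=
  (0 < #|T|)%N /\ forall x y : T, connect e x y.

(* The loops e x x are not drawn. *)
Record plane_drawing (R : realType) (T : finType) (e : rel T)
    (pos : T -> R * R) (arc : T -> T -> R -> R * R) : Prop := PlaneDrawing {
  drawing_pos_inj : injective pos;
  drawing_arc_continuous : forall x y, e x y -> x != y ->
    {within `[0, 1]%classic, continuous (arc x y)};
  drawing_arc_inj : forall x y, e x y -> x != y ->
    {in `[0, 1]%R &, injective (arc x y)};
  drawing_arc_start : forall x y, e x y -> x != y -> arc x y 0 = pos x;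
  drawing_arc_end : forall x y, e x y -> x != y -> arc x y 1 = pos y;
  (* one curve per undirected edge *)
  drawing_arc_rev : forall x y, e x y -> x != y ->
    forall t, t \in `[0, 1]%R -> arc y x t = arc x y (1 - t);
  drawing_arc_vertex : forall x y, e x y -> x != y ->
    forall t z, t \in `]0, 1[%R -> arc x y t <> pos z;
  drawing_arc_disjoint : forall x y u v,
    e x y -> x != y -> e u v -> u != v ->
    [set x; y]%SET != [set u; v]%SET ->
    forall s t, s \in `]0, 1[%R -> t \in `]0, 1[%R -> arc x y s <> arc u v t
}.

Definition planar (R : realType) (T : finType) (e : rel T) : Prop :=
  exists (pos : T -> R * R) (arc : T -> T -> R -> R * R),
    plane_drawing e pos arc.

Definition has_walk (T : finType) (e : rel T) (x y : T) (m : nat) : bool :=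
  [exists p : m.-tuple T, path e x p && (last x p == y)].

(* Least length of a walk from x to y; a shortest walk has length < #|T|, and
   the value is #|T| when there is no walk at all. *)
Definition gdist (T : finType) (e : rel T) (x y : T) : nat :=
  find (has_walk e x y) (iota 0 #|T|).

Definition eccentricity (T : finType) (e : rel T) (x : T) : nat :=
  (\max_(y : T) gdist e x y)%N.

(* The default #|T| is an upper bound of every eccentricity, so this is the
   minimum as soon as T is nonempty. *)
Definition graph_radius (T : finType) (e : rel T) : nat :=
  \big[minn/#|T|]_(x : T) eccentricity e x.

(* Positions of k cops; several cops may share a vertex. *)
Definition cop_position (T : finType) (k : nat) : finType :=
  {ffun 'I_k -> T}.

(* s [::] is the initial placement, and s [:: r_0; ...; r_t] is the placement
   reached by the cops' move of round t+1, when r_0, ..., r_t are the vertices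
   occupied by the robber at the end of rounds 0, ..., t. The earlier cop
   placements are themselves determined by s and this history. *)
Definition cop_strategy (T : finType) (k : nat) : Type :=
  seq T -> cop_position T k.

Definition robber_play (T : finType) (e : rel T) (r : nat -> T) : Prop :=
  forall t, e (r t) (r t.+1).

Definition cops_at (T : finType) (k : nat) (s : cop_strategy T k)
    (r : nat -> T) (t : nat) : cop_position T k :=
  s (mkseq r t).

Definition legal_strategy (T : finType) (e : rel T) (k : nat)
    (s : cop_strategy T k) : Prop :=
  forall r, robber_play e r ->
  forall t (i : 'I_k), e (cops_at s r t i) (cops_at s r t.+1 i).

Definition occupied (T : finType) (k : nat) (c : cop_position T k) (v : T) :
    bool :=
  [exists i : 'I_k, c i == v].

(* A cop and the robber share a vertex during round t: after the robber's move
   (or choice of start), or, in a round t > 0, already after the cops' move. *)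
Definition captured_in (T : finType) (k : nat) (s : cop_strategy T k)
    (r : nat -> T) (t : nat) : bool :=
  occupied (cops_at s r t) (r t) ||
  (0 < t)%N && occupied (cops_at s r t) (r t.-1).

(* +oo if the robber is never captured *)
Definition capture_round (R : realType) (T : finType) (k : nat)
    (s : cop_strategy T k) (r : nat -> T) : \bar R :=
  ereal_inf [set (t%:R)%:E | t in [set t : nat | captured_in s r t]].

Definition strategy_length (R : realType) (T : finType) (e : rel T) (k : nat)
    (s : cop_strategy T k) : \bar R :=
  ereal_sup [set capture_round R s r | r in [set r | robber_play e r]].

(* Finite exactly when k is at least the cop number; the infimum is then
   attained, the possible values being natural numbers or +oo. *)
Definition capt (R : realType) (T : finType) (e : rel T) (k : nat) : \bar R :=
  ereal_inf [set strategy_length R e s |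
             s in [set s : cop_strategy T k | legal_strategy e s]].

(* Main.v *)
(* Put all cops on a center c of G and fix a breadth-first spanning tree. A tree
   path from c is geodesic, so G retracts onto it, and a single cop starting at
   c catches the image of the robber under the retraction within rad(G) rounds;
   afterwards the robber cannot step on the path without being captured. Four
   tree paths suffice to halve the part of the graph still accessible to the
   robber, so log_2 n + 1 phases of rad(G) rounds with four new cops each are
   enough.

   The four paths come from the usual duality argument. Rounding the drawing
   shows that G is obtained from a square grid by contracting connected sets of
   points and deleting edges. The spanning tree lifts to the grid, the faces of
   the grid form a dual tree across the remaining edges, and some face is
   balanced in this dual tree; its (at most four) corners give the paths. *)

(* The drawing enters only through compactness: disjoint pieces of arcs lie at a positive distance,
   and arcs are uniformly continuous. Separation is then obtained on the grid without the Jordan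
   curve theorem, by counting modulo 2: a set of faces has evenly many boundary edges at each point,
   and a closed dual walk is a coboundary. Since every grid point belongs to some vertex, a tree
   path of the grid projects onto a tree path of the graph. The outer face has many corners, but the
   whole rim of the grid belongs to one vertex, so this face costs a single path. Balance is
   measured inside an arbitrary set [W] of vertices, because the set to be halved is the current
   territory of the robber while the tree stays the same throughout.

   Constants: with L the integer part of log_2 n, the L + 1 phases use 4 (L + 1) cops, and L + 1 <=
   3 sqrt n explains the 12. From ln 2 >= 1/2 one gets L + 1 <= 2 L <= 4 ln n for L >= 1, so the
   factor 6 leaves room; a one-vertex graph, where ln n = 0, is captured in round 0. *)
Require Import Defs.
From mathcomp Require Import all_boot.
From mathcomp Require Import zify.

Set Implicit Arguments.
Unset Strict Implicit.
Unset Printing Implicit Defensive.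

(** * Graph distance and restricted connectivity *)

Section Distance.

Variables (T : finType) (e : rel T) (c : T).
Hypothesis conn : forall x, connect e c x.

Lemma gdist_walk x : has_walk e c x (gdist e c x).
Proof.
have [p pp lp] := connectP (conn x).
case: (shortenP pp) lp => q qp uq _ lq.
have sq : size q < #|T| by have := card_uniqP uq => /= <-; exact: max_card.
have hw : has (has_walk e c x) (iota 0 #|T|).
  apply/hasP; exists (size q); first by rewrite mem_iota.
  by apply/existsP; exists (in_tuple q); rewrite /= qp /= lq.
have := nth_find 0 hw; rewrite nth_iota ?add0n //.
by move: hw; rewrite has_find size_iota.
Qed.

Lemma gdist_le_size x m : has_walk e c x m -> gdist e c x <= m.
Proof.
move=> wm; rewrite leqNgt; apply/negP => mlt.
have mT : m < #|T|.
  by apply: leq_trans mlt _; rewrite -[#|T|](size_iota 0) find_size.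
by have := before_find 0 mlt; rewrite nth_iota // add0n wm.
Qed.

Lemma gdist_root : gdist e c c = 0.
Proof.
apply/eqP; rewrite -leqn0; apply: gdist_le_size.
by apply/existsP; exists [tuple]; rewrite /= eqxx.
Qed.

Lemma gdist_step x y : e x y -> gdist e c y <= (gdist e c x).+1.
Proof.
move=> exy; apply: gdist_le_size.
have /existsP[p /andP[pp /eqP lp]] := gdist_walk x.
apply/existsP; exists [tuple of rcons p y].
by rewrite /= rcons_path last_rcons pp lp exy eqxx.
Qed.

Lemma gdist_pred x : x != c ->
  exists2 y, e y x & gdist e c x = (gdist e c y).+1.
Proof.
move=> xc; have /existsP[[p sp] /=] := gdist_walk x.
case/lastP: p sp => [|p z] sp.
  by move=> /= /eqP cx; rewrite cx eqxx in xc.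
rewrite rcons_path last_rcons => /andP[/andP[pp ez] /eqP zx].
rewrite {z}zx in sp ez; exists (last c p) => //.
apply/eqP; rewrite eqn_leq gdist_step //=.
rewrite -(eqP sp) size_rcons ltnS; apply: gdist_le_size.
by apply/existsP; exists (in_tuple p); rewrite /= pp eqxx.
Qed.

(** Applied twice: to the graph itself, and to the directed relation [down] on grid points that
    lifts its tree. The arrow from [par x] to [x] therefore matters. *)
Lemma bfs_parent : exists par : T -> T, par c = c /\
  forall x, x != c -> e (par x) x /\ gdist e c x = (gdist e c (par x)).+1.
Proof.
pose P x y := if x == c then y == c
              else e y x && (gdist e c x == (gdist e c y).+1).
have exP x : exists y, P x y.
  rewrite /P; case: eqP => [_|/eqP xc]; first by exists c.
  by have [y eyx ->] := gdist_pred xc; exists y; rewrite eyx eqxx.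
have [par parP] := fin_all_exists exP.
exists par; split; first by have := parP c; rewrite /P eqxx => /eqP.
by move=> x xc; have := parP x; rewrite /P (negbTE xc) => /andP[-> /eqP].
Qed.

End Distance.

Section Restriction.

Variables (X : finType) (e : rel X).

Definition restr_rel (A : pred X) : rel X :=
  fun x y => [&& e x y, A x & A y].

Lemma restr_rel_sym A : symmetric e -> symmetric (restr_rel A).
Proof. by move=> es x y; rewrite /restr_rel es [A x && _]andbC. Qed.

Lemma restr_connect_in A x y : connect (restr_rel A) x y -> A x -> A y.
Proof.
move=> /connectP[p pp ->]; elim: p x pp => [|z p IH] x //=.
by case/andP=> /and3P[_ _ Az] pp _; exact: IH pp Az.
Qed.

Lemma restr_connectS (A B : pred X) x y :
  (forall z, A z -> B z) -> connect (restr_rel A) x y ->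
  connect (restr_rel B) x y.
Proof.
move=> AB; apply: connect_sub => u v /= /and3P[euv Au Av].
by apply: connect1; rewrite /restr_rel euv !AB.
Qed.

Lemma connect_restr (e' : rel X) (A : pred X) x y :
  (forall u v, A u -> e' u v -> e u v /\ A v) -> A x ->
  connect e' x y -> connect (restr_rel A) x y.
Proof.
move=> H Ax /connectP[p pp ->]; elim: p x Ax pp => [|z p IH] x Ax //=.
case/andP=> exz pp; have [exz' Az] := H _ _ Ax exz.
apply: connect_trans (connect1 _) (IH _ Az pp).
by rewrite /restr_rel exz' Ax Az.
Qed.

Lemma connect_exit (A : pred X) x y : connect e x y -> A x -> ~~ A y ->
  exists u v, [/\ e u v, A u & ~~ A v].
Proof.
move=> /connectP[p pp ->]; elim: p x pp => [|z p IH] x /=; first by move=> _ ->.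
case/andP=> exz pp Ax nA; case: (boolP (A z)) => Az; first exact: IH pp Az nA.
by exists x, z.
Qed.

End Restriction.
Lemma connect_closed (X : finType) (e : rel X) (P : X -> Prop) x y :
  P x -> (forall u v, P u -> e u v -> P v) -> connect e x y -> P y.
Proof.
move=> Px H /connectP[p pp ->]; elim: p x Px pp => [|z p IH] x Px //=.
by case/andP=> /(H _ _ Px); exact: IH.
Qed.

(** * Balanced faces of a square grid *)

Section Grid.

Variable n : nat.

Local Notation gpoint := ('I_n.+1 * 'I_n.+1)%type.

Definition pt (i j : nat) : gpoint := (inord i, inord j).

Definition gadj : rel gpoint := fun x y =>
  (x.1 == y.1 :> nat) && ((x.2.+1 == y.2) || (y.2.+1 == x.2)) ||
  (x.2 == y.2 :> nat) && ((x.1.+1 == y.1) || (y.1.+1 == x.1)).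

(* The square with corners (i-1, j-1), (i-1, j), (i, j-1), (i, j); all the
   squares that leave the grid are merged into the outer face None. *)
Definition face (i j : nat) : option gpoint :=
  if (0 < i <= n) && (0 < j <= n) then Some (pt i j) else None.

Definition faces_at (x : gpoint) : seq (option gpoint) :=
  [:: face x.1 x.2; face x.1.+1 x.2; face x.1 x.2.+1; face x.1.+1 x.2.+1].

(** For adjacent points, [side1] is the face below a horizontal edge or left of a vertical one, and
    [side2] is the face across the edge. *)
Definition side1 (x y : gpoint) := face (maxn x.1 y.1) (maxn x.2 y.2).

Definition side2 (x y : gpoint) :=
  if x.1 == y.1 :> nat then face x.1.+1 (maxn x.2 y.2)
  else face (maxn x.1 y.1) x.2.+1.

Lemma pt1 i j : i <= n -> (pt i j).1 = i :> nat.
Proof. by move=> h; rewrite inordK. Qed.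

Lemma pt2 i j : j <= n -> (pt i j).2 = j :> nat.
Proof. by move=> h; rewrite inordK. Qed.

Lemma ptE (x : gpoint) : pt x.1 x.2 = x.
Proof. by case: x => a b; rewrite /pt !inord_val. Qed.

Lemma pt_eq (x : gpoint) i j : x.1 = i :> nat -> x.2 = j :> nat -> x = pt i j.
Proof. by move=> <- <-; rewrite ptE. Qed.

Lemma pt_inj a b c d : a <= n -> b <= n -> c <= n -> d <= n ->
  pt a b = pt c d -> a = c /\ b = d.
Proof.
move=> ha hb hc hd [] /(congr1 val) + /(congr1 val).
by rewrite /= !inordK.
Qed.

Lemma coord1_le (x : gpoint) : x.1 <= n. Proof. by rewrite -ltnS. Qed.
Lemma coord2_le (x : gpoint) : x.2 <= n. Proof. by rewrite -ltnS. Qed.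

Lemma gadj_sym : symmetric gadj.
Proof.
move=> x y; rewrite /gadj [y.1 == x.1 :> nat]eq_sym [y.2 == x.2 :> nat]eq_sym.
by rewrite [(y.2.+1 == x.2) || _]orbC [(y.1.+1 == x.1) || _]orbC.
Qed.

Lemma gadjP x y : gadj x y ->
  [\/ x.1 < n /\ y = pt x.1.+1 x.2, 0 < x.1 /\ y = pt x.1.-1 x.2,
      x.2 < n /\ y = pt x.1 x.2.+1 | 0 < x.2 /\ y = pt x.1 x.2.-1].
Proof.
have := coord1_le x; have := coord2_le x.
have := coord1_le y; have := coord2_le y.
rewrite /gadj => h1 h2 h3 h4 /orP[] /andP[/eqP E /orP[] /eqP E'].
- by constructor 3; split; [lia | apply: pt_eq; lia].
- by constructor 4; split; [lia | apply: pt_eq; lia].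
- by constructor 1; split; [lia | apply: pt_eq; lia].
- by constructor 2; split; [lia | apply: pt_eq; lia].
Qed.

Lemma gadj_right i j : i < n -> j <= n -> gadj (pt i j) (pt i.+1 j).
Proof. by move=> hi hj; rewrite /gadj !pt1 ?pt2 ?eqxx ?orbT // ltnW. Qed.

Lemma gadj_up i j : i <= n -> j < n -> gadj (pt i j) (pt i j.+1).
Proof. by move=> hi hj; rewrite /gadj !pt1 ?pt2 ?eqxx ?orbT // ltnW. Qed.

Lemma side1_right i j : i < n -> j <= n ->
  side1 (pt i j) (pt i.+1 j) = face i.+1 j.
Proof.
by move=> hi hj; rewrite /side1 !pt1 ?pt2 ?maxnn ?(maxn_idPr _) // ltnW.
Qed.

Lemma side2_right i j : i < n -> j <= n ->
  side2 (pt i j) (pt i.+1 j) = face i.+1 j.+1.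
Proof.
move=> hi hj; rewrite /side2 !pt1 ?pt2 ?maxnn ?(maxn_idPr _) //; try lia.
by case: eqP => // ?; exfalso; lia.
Qed.

Lemma side1_up i j : i <= n -> j < n ->
  side1 (pt i j) (pt i j.+1) = face i j.+1.
Proof.
by move=> hi hj; rewrite /side1 !pt1 ?pt2 ?maxnn ?(maxn_idPr _) // ltnW.
Qed.

Lemma side2_up i j : i <= n -> j < n ->
  side2 (pt i j) (pt i j.+1) = face i.+1 j.+1.
Proof.
move=> hi hj; rewrite /side2 !pt1 ?pt2 ?eqxx ?maxnn ?(maxn_idPr _) //; lia.
Qed.

Lemma side1C x y : side1 x y = side1 y x.
Proof. by rewrite /side1 maxnC [maxn x.2 _]maxnC. Qed.

Lemma side2C x y : gadj x y -> side2 x y = side2 y x.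
Proof.
rewrite /gadj /side2 [y.1 == x.1 :> nat]eq_sym => /orP[] /andP[/eqP E h].
  by rewrite E eqxx maxnC.
case: (eqVneq (x.1 : nat) y.1) => [E'|_]; last by rewrite maxnC E.
by exfalso; case/orP: h => /eqP ?; lia.
Qed.

Lemma side_faces_at x y : gadj x y ->
  side1 x y \in faces_at x /\ side2 x y \in faces_at x.
Proof.
move=> adj; split; last rewrite /side2; rewrite ?/side1 /faces_at.
  case/orP: adj => /andP[/eqP -> /orP[] /eqP E]; rewrite maxnn.
  - by rewrite (_ : maxn _ _ = x.2.+1) ?inE ?eqxx ?orbT //; lia.
  - by rewrite (_ : maxn _ _ = x.2) ?inE ?eqxx ?orbT //; lia.
  - by rewrite (_ : maxn _ _ = x.1.+1) ?inE ?eqxx ?orbT //; lia.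
  - by rewrite (_ : maxn _ _ = x.1) ?inE ?eqxx ?orbT //; lia.
case/orP: adj => /andP[/eqP E' /orP[] /eqP E].
- by rewrite E' eqxx (_ : maxn _ _ = x.2.+1) ?inE ?eqxx ?orbT //; lia.
- by rewrite E' eqxx (_ : maxn _ _ = x.2) ?inE ?eqxx ?orbT //; lia.
- rewrite (_ : maxn x.1 _ = x.1.+1); last lia.
  by case: eqP => [?|_]; [exfalso; lia | rewrite ?inE ?eqxx ?orbT].
- rewrite (_ : maxn x.1 _ = x.1); last lia.
  by case: eqP => [?|_]; [exfalso; lia | rewrite ?inE ?eqxx ?orbT].
Qed.

(* bd x y says that the edge xy lies on the boundary of the set FF of faces;
   around every vertex there are evenly many such edges. *)
Lemma boundary_even (FF : pred (option gpoint)) z p :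
  let bd x y := FF (side1 x y) (+) FF (side2 x y) in
  gadj z p -> (forall w, gadj z w -> w != p -> ~~ bd z w) -> ~~ bd z p.
Proof.
move=> bd zp H.
have [i [j [lz1 lz2 Ez]]] : exists i j : nat, [/\ i <= n, j <= n & z = pt i j].
  by exists z.1, z.2; rewrite coord1_le coord2_le ptE.
have eq_addb a b : ~~ (a (+) b) = (a == b) by case: a b => [] [].
have bdC x y : gadj x y -> bd x y = bd y x.
  by move=> xy; rewrite /bd side1C side2C.
have bdR : i < n ->
    bd z (pt i.+1 j) = FF (face i.+1 j) (+) FF (face i.+1 j.+1).
  by move=> hi; rewrite /bd {1 2}Ez side1_right ?side2_right.
have bdU : j < n ->
    bd z (pt i j.+1) = FF (face i j.+1) (+) FF (face i.+1 j.+1).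
  by move=> hj; rewrite /bd {1 2}Ez side1_up ?side2_up.
have adjR : i < n -> gadj z (pt i.+1 j) by move=> hi; rewrite Ez gadj_right.
have adjU : j < n -> gadj z (pt i j.+1) by move=> hj; rewrite Ez gadj_up.
have adjL : 0 < i -> gadj z (pt i.-1 j).
  move=> hi; rewrite gadj_sym Ez; have := @gadj_right i.-1 j.
  by rewrite prednK //; apply.
have adjD : 0 < j -> gadj z (pt i j.-1).
  move=> hj; rewrite gadj_sym Ez; have := @gadj_up i j.-1.
  by rewrite prednK //; apply.
have bdL : 0 < i ->
    bd z (pt i.-1 j) = FF (face i j) (+) FF (face i j.+1).
  move=> hi; rewrite bdC ?adjL // /bd {1 2}Ez.
  have := @side1_right i.-1 j; have := @side2_right i.-1 j.
  by rewrite prednK // => -> // ->.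
have bdD : 0 < j ->
    bd z (pt i j.-1) = FF (face i j) (+) FF (face i.+1 j).
  move=> hj; rewrite bdC ?adjD // /bd {1 2}Ez.
  have := @side1_up i j.-1; have := @side2_up i j.-1.
  by rewrite prednK // => -> // ->.
(* In each of the four directions, either the neighbour is [p], or the two faces on that side of [z]
   agree: by hypothesis, or because both are the outer face at the rim. Three agreements around [z]
   force the fourth. *)
have R : (i < n /\ p = pt i.+1 j) \/ FF (face i.+1 j) = FF (face i.+1 j.+1).
  case: (leqP n i) => hi.
    by right; rewrite /face [i < n]ltnNge hi !andbF.
  case: (eqVneq p (pt i.+1 j)) => [->|np]; first by left; split.
  by right; apply/eqP; rewrite -eq_addb -bdR // H ?adjR // eq_sym.
have U : (j < n /\ p = pt i j.+1) \/ FF (face i j.+1) = FF (face i.+1 j.+1).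
  case: (leqP n j) => hj.
    by right; rewrite /face [j < n]ltnNge hj !andbF.
  case: (eqVneq p (pt i j.+1)) => [->|np]; first by left; split.
  by right; apply/eqP; rewrite -eq_addb -bdU // H ?adjU // eq_sym.
have L : (i.-1 <= n /\ p = pt i.-1 j) \/ FF (face i j) = FF (face i j.+1).
  case: (posnP i) => [->|hi]; first by right.
  case: (eqVneq p (pt i.-1 j)) => [->|np].
    by left; split=> //; exact: leq_trans (leq_pred _) _.
  by right; apply/eqP; rewrite -eq_addb -bdL // H ?adjL // eq_sym.
have D : (j.-1 <= n /\ p = pt i j.-1) \/ FF (face i j) = FF (face i.+1 j).
  case: (posnP j) => [->|hj]; first by right; rewrite /face /= !andbF.
  case: (eqVneq p (pt i j.-1)) => [->|np].
    by left; split=> //; exact: leq_trans (leq_pred _) _.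
  by right; apply/eqP; rewrite -eq_addb -bdD // H ?adjD // eq_sym.
have [[lt E]|[lt E]|[lt E]|[lt E]] := gadjP zp;
  rewrite Ez ?pt1 ?pt2 // in lt E.
- rewrite E bdR //.
  case: U => [[h U]|U].
    case: (pt_inj lt lz2 lz1 h (etrans (esym E) U)); clear -lt; lia.
  case: L => [[h L]|L].
    case: (pt_inj lt lz2 h lz2 (etrans (esym E) L)); clear -lt; lia.
  case: D => [[h D]|D].
    case: (pt_inj lt lz2 lz1 h (etrans (esym E) D)); clear -lt; lia.
  by rewrite -U -L -D addbb.
- rewrite E bdL //.
  have lt' : i.-1 <= n by exact: leq_trans (leq_pred _) _.
  case: U => [[h U]|U].
    case: (pt_inj lt' lz2 lz1 h (etrans (esym E) U)); clear -lt; lia.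
  case: R => [[h R]|R].
    case: (pt_inj lt' lz2 h lz2 (etrans (esym E) R)); clear -lt; lia.
  case: D => [[h D]|D].
    case: (pt_inj lt' lz2 lz1 h (etrans (esym E) D)); clear -lt; lia.
  by rewrite U -R -D addbb.
- rewrite E bdU //.
  case: R => [[h R]|R].
    case: (pt_inj lz1 lt h lz2 (etrans (esym E) R)); clear -lt; lia.
  case: L => [[h L]|L].
    case: (pt_inj lz1 lt h lz2 (etrans (esym E) L)); clear -lt; lia.
  case: D => [[h D]|D].
    case: (pt_inj lz1 lt lz1 h (etrans (esym E) D)); clear -lt; lia.
  by rewrite -R -L -D addbb.
- rewrite E bdD //.
  have lt' : j.-1 <= n by exact: leq_trans (leq_pred _) _.
  case: U => [[h U]|U].
    case: (pt_inj lz1 lt' lz1 h (etrans (esym E) U)); clear -lt; lia.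
  case: L => [[h L]|L].
    case: (pt_inj lz1 lt' h lz2 (etrans (esym E) L)); clear -lt; lia.
  case: R => [[h R]|R].
    case: (pt_inj lz1 lt' h lz2 (etrans (esym E) R)); clear -lt; lia.
  by rewrite L R -U addbb.
Qed.

(** * Spanning trees of the grid and their dual cotrees *)

Section GridTree.

Variables (r : gpoint) (par : gpoint -> gpoint) (rk : gpoint -> nat).
Hypothesis par_root : par r = r.
Hypothesis par_adj : forall z, z != r -> gadj (par z) z.
Hypothesis par_rk : forall z, z != r -> rk (par z) < rk z.

Definition tree_edge (x y : gpoint) := (par x == y) || (par y == x).

Lemma tree_edgeC x y : tree_edge x y = tree_edge y x.
Proof. exact: orbC. Qed.

Lemma gadj_irr x : gadj x x = false.
Proof. by rewrite /gadj !eqxx /= !eqn_leq !ltnn. Qed.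

(* A nonempty even edge set cannot live in a forest: look at its vertex of
   largest rank. *)
Lemma boundary_tree (FF : pred (option gpoint)) (A : pred gpoint) :
  let bd x y := FF (side1 x y) (+) FF (side2 x y) in
  (forall z, A z -> A (par z)) ->
  (forall x y, gadj x y -> ~~ A x -> bd x y -> tree_edge x y) ->
  forall x y, gadj x y -> ~~ A x -> ~~ bd x y.
Proof.
move=> bd Aup H x y xy nAx; apply/negP => bxy.
have bdC u v : gadj u v -> bd u v = bd v u.
  by move=> uv; rewrite /bd side1C side2C.
pose bad z := [&& z != r, ~~ A z & bd z (par z)].
(* [A] is closed under parents, so children of points outside [A] stay outside [A], where boundary
   edges are known to be tree edges. *)
have bad_child u v : gadj u v -> ~~ A u -> bd u v -> par v = u -> bad v.
  move=> uv nAu buv pv; rewrite /bad pv -bdC // buv andbT.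
  apply/andP; split; last by apply: contra nAu => /Aup; rewrite pv.
  by apply: contraTneq uv => vr; rewrite -pv vr par_root gadj_irr.
have [z0 bz0] : exists z, bad z.
  case/orP: (H _ _ xy nAx bxy) => /eqP E; last first.
    by exists y; exact: bad_child E.
  exists x; rewrite /bad nAx E bxy !andbT.
  by apply: contraTneq xy => xr; rewrite -E xr par_root gadj_irr.
case: (@arg_maxnP _ z0 bad rk bz0) => z /and3P[zr nAz bz] zmax.
suff : ~~ bd z (par z) by rewrite bz.
apply: (@boundary_even FF z (par z)); first by rewrite gadj_sym par_adj.
move=> w zw wp; apply/negP => bzw.
have := H _ _ zw nAz bzw; rewrite /tree_edge eq_sym (negbTE wp) /= => /eqP pw.
have bw := bad_child _ _ zw nAz bzw pw.
have /and3P[wr _ _] := bw.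
by have := leq_trans (par_rk wr) (zmax _ bw); rewrite pw ltnn.
Qed.

Definition dual_edge (x y : gpoint) (f g : option gpoint) :=
  [|| (f == side1 x y) && (g == side2 x y)
    | (g == side1 x y) && (f == side2 x y)].

Definition cotree : rel (option gpoint) := fun f g =>
  [exists x, exists y, [&& gadj x y, ~~ tree_edge x y & dual_edge x y f g]].

(** Its components other than [t] itself are the branches of the cotree at the face [t]. *)
Definition cotree_off (t : option gpoint) : rel (option gpoint) :=
  restr_rel cotree (predC1 t).

Lemma cotreeP f g :
  reflect (exists x y, [/\ gadj x y, ~~ tree_edge x y & dual_edge x y f g])
          (cotree f g).
Proof.
apply: (iffP existsP) => [[x /existsP[y /and3P[]]]|[x [y [h1 h2 h3]]]].
  by move=> *; exists x, y.
by exists x; apply/existsP; exists y; rewrite h1 h2 h3.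
Qed.

Lemma dual_edgeC x y f g : dual_edge x y f g = dual_edge x y g f.
Proof. by rewrite /dual_edge orbC. Qed.

Lemma cotree_sym : symmetric cotree.
Proof.
by move=> f g; apply/cotreeP/cotreeP => -[x [y [h1 h2 h3]]]; exists x, y;
   split=> //; rewrite dual_edgeC.
Qed.

Lemma cotree_off_sym t : symmetric (cotree_off t).
Proof. exact: restr_rel_sym cotree_sym. Qed.

Lemma cotree_off_connectC t : connect_sym (cotree_off t).
Proof. exact/sym_connect_sym/cotree_off_sym. Qed.

Lemma tree_edge_off (e : rel (option gpoint)) (g : option gpoint) x y :
    symmetric e ->
    (~~ tree_edge x y -> e (side1 x y) (side2 x y)) ->
  connect e g (side1 x y) (+) connect e g (side2 x y) -> tree_edge x y.
Proof.
move=> es he; apply: contraTT => /he {}he.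
by rewrite (same_connect_r (sym_connect_sym es) (connect1 he)) addbb.
Qed.

(** The boundary of the component of [None] uses tree edges only, so it is empty by [boundary_tree].
    Descending a column of faces then ends in [None]. *)
Lemma cotree_connected i j : connect cotree None (face i j).
Proof.
pose FF f := connect cotree None f.
have nobd x y : gadj x y -> FF (side1 x y) = FF (side2 x y).
  move=> xy; suff : ~~ (FF (side1 x y) (+) FF (side2 x y)) by do 2!case: (FF _).
  apply: (@boundary_tree FF pred0 _ _ x y) => // u v uv _.
  apply: (tree_edge_off cotree_sym) => nt.
  by apply/cotreeP; exists u, v; rewrite /dual_edge !eqxx.
suff H : forall i j, FF (face i j) by [].
move=> {i j} i; elim=> [|j IH]; first by rewrite /FF /face andbF connect0.
case: (boolP ((0 < i <= n) && (0 < j.+1 <= n))) => [|ni]; last first.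
  by rewrite /face (negbTE ni) /FF connect0.
case/andP => /andP[i0 hi] /andP[_ hj].
have hi' : i.-1 < n by rewrite prednK.
have := nobd _ _ (gadj_right hi' (ltnW hj)).
by rewrite side1_right ?side2_right ?prednK // ?(ltnW hj) // => <-.
Qed.

Lemma dual_edge_faces x y f g : gadj x y -> dual_edge x y f g ->
  f \in faces_at x.
Proof.
move=> xy; have [s1 s2] := side_faces_at xy.
by case/orP => /andP[/eqP E1 /eqP E2]; rewrite ?E1 ?E2.
Qed.

Definition corner_below (t : option gpoint) (z : gpoint) :=
  [exists a, (t \in faces_at a) && fconnect par a z].

(** The points above some corner of [t] form a set closed under parents. Outside it no face at a
    point is [t], so deleting [t] loses no cotree edge there, and [boundary_tree] shows that no
    branch at [t] has a boundary edge at [x]. *)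
Lemma faces_at_same t x f g : ~~ corner_below t x ->
  f \in faces_at x -> g \in faces_at x -> connect (cotree_off t) f g.
Proof.
move=> nx fx gx; pose FF h := connect (cotree_off t) f h.
have nobd y : gadj x y -> FF (side1 x y) = FF (side2 x y).
  move=> xy; suff : ~~ (FF (side1 x y) (+) FF (side2 x y)) by do 2!case: (FF _).
  apply: (@boundary_tree FF (corner_below t) _ _ x y) => // [z|].
    case/existsP=> a /andP[ta az]; apply/existsP; exists a; rewrite ta.
    exact: connect_trans az (fconnect1 _ _).
  move=> u v uv nu.
  apply: (tree_edge_off (@cotree_off_sym t)) => nt.
  have [s1 s2] := side_faces_at uv.
  have tu h : h \in faces_at u -> h != t.
    apply: contraTneq => ->; apply: contra nu => tu; apply/existsP.
    by exists u; rewrite tu connect0.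
  rewrite /cotree_off /restr_rel /= !tu // !andbT.
  by apply/cotreeP; exists u, v; rewrite /dual_edge !eqxx.
have [i [j [li lj Ex]]] : exists i j : nat, [/\ i <= n, j <= n & x = pt i j].
  by exists x.1, x.2; rewrite coord1_le coord2_le ptE.
rewrite {}Ex in nobd fx gx *.
have R : FF (face i.+1 j) = FF (face i.+1 j.+1).
  case: (leqP n i) => hi; first by rewrite /face [i < n]ltnNge hi !andbF.
  by have := nobd _ (gadj_right hi lj); rewrite side1_right ?side2_right.
have U : FF (face i j.+1) = FF (face i.+1 j.+1).
  case: (leqP n j) => hj; first by rewrite /face [j < n]ltnNge hj !andbF.
  by have := nobd _ (gadj_up li hj); rewrite side1_up ?side2_up.
have L : FF (face i j) = FF (face i j.+1).
  case: (posnP i) => [->|hi] //.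
  have adj : gadj (pt i.-1 j) (pt i j).
    by have := @gadj_right i.-1 j; rewrite prednK //; apply.
  have hi' : i.-1 < n by rewrite prednK.
  have := nobd (pt i.-1 j); rewrite gadj_sym adj side1C side2C 1?gadj_sym //.
  have := side1_right hi' lj; have := side2_right hi' lj.
  by rewrite prednK // => -> -> ->.
rewrite -/(FF g); have := connect0 (cotree_off t) f; rewrite -/(FF f).
move: fx gx; rewrite /faces_at pt1 // pt2 // !inE.
have E1 : FF (face i.+1 j) = FF (face i j) by rewrite R -U L.
have E2 : FF (face i j.+1) = FF (face i j) by rewrite L.
have E3 : FF (face i.+1 j.+1) = FF (face i j) by rewrite -U -L.
have FFx h : [|| h == face i j, h == face i.+1 j, h == face i j.+1
               | h == face i.+1 j.+1] -> FF h = FF (face i j).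
  by case/or4P=> /eqP->.
by move=> /FFx -> /FFx ->.
Qed.

(** The sum modulo 2 of [c] over the four sides of the square with lower left corner (i, j). Reading
    [c] as a set of crossed edges, this is the boundary of a dual chain at that face; the outer face
    is never tested. *)
Definition chain_boundary (c : rel gpoint) (i j : nat) : bool :=
  c (pt i j) (pt i.+1 j) (+) c (pt i j.+1) (pt i.+1 j.+1)
  (+) (c (pt i j) (pt i j.+1) (+) c (pt i.+1 j) (pt i.+1 j.+1)).

Definition edge_chain (u v : gpoint) : rel gpoint :=
  fun a b => (a == u) && (b == v) || (a == v) && (b == u).

Lemma edge_chainC u v a b : edge_chain u v a b = edge_chain v u a b.
Proof. exact: orbC. Qed.

Lemma pt_eqE a b c d : a <= n -> b <= n -> c <= n -> d <= n ->
  (pt a b == pt c d) = (a == c) && (b == d).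
Proof.
move=> ha hb hc hd; apply/eqP/andP => [/pt_inj[]// -> ->|[/eqP-> /eqP->] //].
by rewrite !eqxx.
Qed.

Lemma face_eqE i j a b : i < n -> j < n ->
  (face i.+1 j.+1 == face a b) = (i.+1 == a) && (j.+1 == b).
Proof.
move=> hi hj; rewrite /face ltn0Sn hi ltn0Sn hj /=; case: ifP => [|nab].
  by case/andP=> /andP[_ ha] /andP[_ hb]; rewrite -pt_eqE.
symmetry; apply/negP => /andP[/eqP Ea /eqP Eb].
by move: nab; rewrite -Ea -Eb !ltn0Sn hi hj.
Qed.

Lemma chain_boundary_edge u v i j : gadj u v -> i < n -> j < n ->
  chain_boundary (edge_chain u v) i j =
  (face i.+1 j.+1 == side1 u v) (+) (face i.+1 j.+1 == side2 u v).
Proof.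
have nS m : (m.+1 == m) = false by clear; lia.
have nS' m : (m == m.+1) = false by clear; lia.
have nSS m : (m.+2 == m) = false by clear; lia.
pose simp := (nS, nS', nSS, eqxx, eqSS, andbF, orbF, addbF, addFb).
have right a b : a < n -> b <= n -> i < n -> j < n ->
  chain_boundary (edge_chain (pt a b) (pt a.+1 b)) i j =
  (face i.+1 j.+1 == face a.+1 b) (+) (face i.+1 j.+1 == face a.+1 b.+1).
  move=> ha hb hi hj; rewrite !face_eqE // /chain_boundary /edge_chain.
  rewrite !pt_eqE //; try exact: ltnW.
  case: (eqVneq i a) => [->|ia]; last first.
    case: (eqVneq i a.+1) => [->|ia']; rewrite ?simp //=.
    by rewrite (negbTE ia) /= ?andbF.
  rewrite !simp /=; case: (eqVneq j b) => [->|jb]; rewrite ?simp //=.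
  by case: eqP; rewrite ?simp.
have up a b : a <= n -> b < n -> i < n -> j < n ->
  chain_boundary (edge_chain (pt a b) (pt a b.+1)) i j =
  (face i.+1 j.+1 == face a b.+1) (+) (face i.+1 j.+1 == face a.+1 b.+1).
  move=> ha hb hi hj; rewrite !face_eqE // /chain_boundary /edge_chain.
  rewrite !pt_eqE //; try exact: ltnW.
  case: (eqVneq j b) => [->|jb]; last first.
    case: (eqVneq j b.+1) => [->|jb']; rewrite ?simp //=.
    by rewrite (negbTE jb) ?andbF /= ?andbF.
  rewrite !simp /=; case: (eqVneq i a) => [->|ia]; rewrite ?simp //=.
  by case: eqP; rewrite ?simp.
have sym w z : gadj w z -> chain_boundary (edge_chain z w) i j =
    (face i.+1 j.+1 == side1 z w) (+) (face i.+1 j.+1 == side2 z w) ->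
  chain_boundary (edge_chain w z) i j =
    (face i.+1 j.+1 == side1 w z) (+) (face i.+1 j.+1 == side2 w z).
  move=> wz; rewrite /chain_boundary (side1C w z) (side2C wz) => <-.
  by rewrite ![edge_chain w z _ _]edge_chainC.
move=> uv hi hj.
have [a [b [la lb Eu]]] : exists a b : nat, [/\ a <= n, b <= n & u = pt a b].
  by exists u.1, u.2; rewrite coord1_le coord2_le ptE.
have [[h E]|[h E]|[h E]|[h E]] := gadjP uv;
  rewrite {u}Eu ?pt1 ?pt2 // in h E uv *.
- by rewrite E right // side1_right // side2_right.
- have h' : a.-1 < n by rewrite prednK.
  apply: sym => //; rewrite E; have := right a.-1 b h' lb hi hj.
  have := side1_right h' lb; have := side2_right h' lb.
  by rewrite prednK // => -> ->.
- by rewrite E up // side1_up // side2_up.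
- have h' : b.-1 < n by rewrite prednK.
  apply: sym => //; rewrite E; have := up a b.-1 la h' hi hj.
  have := side1_up la h'; have := side2_up la h'.
  by rewrite prednK // => -> ->.
Qed.

(* A closed dual walk is the coboundary of a function on the points (the square
   is simply connected); if it avoids the tree, that function is constant. *)
Lemma chain_zero (c : rel gpoint) :
  symmetric c -> (forall x y, tree_edge x y -> c x y = false) ->
  (forall i j, i < n -> j < n -> chain_boundary c i j = false) ->
  forall x y, gadj x y -> c x y = false.
Proof.
move=> cs ct cb.
(* The potential of (i, j): the sum of [c] along the bottom row and then up column i. Vanishing
   around every square makes it independent of the route. *)
pose kap (i j : nat) := \big[addb/false]_(a < i) c (pt a 0) (pt a.+1 0)
             (+) \big[addb/false]_(b < j) c (pt i b) (pt i b.+1).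
have kapU i j : kap i j.+1 = kap i j (+) c (pt i j) (pt i j.+1).
  by rewrite /kap big_ord_recr /= addbA.
have kapR i j : i < n -> j <= n ->
    kap i.+1 j = kap i j (+) c (pt i j) (pt i.+1 j).
  move=> hi; elim: j => [_|j IH hj].
    by rewrite /kap !big_ord0 big_ord_recr /= !addbF.
  rewrite !kapU IH; last exact: ltnW.
  have := cb i j hi hj; rewrite /chain_boundary.
  by do 4!case: (c _ _); case: (kap i j).
pose k (x : gpoint) := kap x.1 x.2.
have kc x y : gadj x y -> c x y = k x (+) k y.
  have lx1 := coord1_le x; have lx2 := coord2_le x.
  case/gadjP=> -[h E].
  - rewrite E /k pt1 // pt2 // kapR // ptE.
    by case: (kap _ _); case: (c _ _).
  - have h' : x.1.-1 < n by rewrite prednK.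
    have := kapR _ _ h' lx2; rewrite prednK // ptE -E cs => E'.
    rewrite /k E' E pt1 ?pt2 ?(ltnW h') //.
    by case: (kap _ _); case: (c _ _).
  - rewrite E /k pt1 // pt2 // kapU ptE.
    by case: (kap _ _); case: (c _ _).
  - have h' : x.2.-1 < n by rewrite prednK.
    have := kapU x.1 x.2.-1; rewrite prednK // ptE -E cs => E'.
    rewrite /k E' E pt1 ?pt2 ?(ltnW h') //.
    by case: (kap _ _); case: (c _ _).
have kr m : forall x, rk x < m -> k x = k r.
  elim: m => [//|m IH] x; rewrite ltnS => hx.
  case: (eqVneq x r) => [-> //|xr].
  rewrite -(IH (par x)); last exact: leq_trans (par_rk xr) hx.
  have := kc _ _ (par_adj xr); rewrite ct; last by rewrite /tree_edge eqxx orbT.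
  by case: (k x); case: (k (par x)).
by move=> x y xy; rewrite kc // (kr _ x (leqnn _)) (kr _ y (leqnn _)) addbb.
Qed.

(** Every cotree edge is a bridge. A dual path between the two sides of xy that does not cross xy
    becomes, once xy is added, a closed dual chain avoiding the tree; by [chain_zero] it would be
    empty, yet it contains xy. *)
Lemma cotree_bridge (e : rel (option gpoint)) x y :
  gadj x y -> ~~ tree_edge x y ->
  (forall f g, e f g -> exists u v, [/\ gadj u v, ~~ tree_edge u v,
     dual_edge u v f g & ~~ edge_chain x y u v]) ->
  ~~ connect e (side1 x y) (side2 x y).
Proof.
move=> xy nt He; apply/negP => con.
(* The invariant along a dual path from [side1 x y] to [f]: the crossed edges, counted modulo 2,
   form a chain whose boundary is the two ends of the path. *)
pose P f := exists c : rel gpoint, [/\ symmetric c,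
  forall u v, tree_edge u v -> c u v = false, c x y = false &
  forall i j, i < n -> j < n -> chain_boundary c i j =
    (face i.+1 j.+1 == side1 x y) (+) (face i.+1 j.+1 == f)].
have ecs u v : symmetric (edge_chain u v).
  by move=> a b; rewrite /edge_chain orbC andbC [_ && (b == v)]andbC.
have ect u v : ~~ tree_edge u v ->
    forall a b, tree_edge a b -> edge_chain u v a b = false.
  move=> ntu a b tab; apply/negP => /orP[] /andP[/eqP Ea /eqP Eb].
    by move: ntu; rewrite -Ea -Eb tab.
  by move: ntu; rewrite -Ea -Eb tree_edgeC tab.
have cbD c c' i j : chain_boundary (fun a b => c a b (+) c' a b) i j =
    chain_boundary c i j (+) chain_boundary c' i j.
  rewrite /chain_boundary; set l := pt i j.
  by do 4![case: (c _ _)]; do 4![case: (c' _ _)].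
have [c [cs ct cxy cb]] : P (side2 x y).
  apply: connect_closed con.
    exists (fun _ _ => false); split=> // i j hi hj.
    by rewrite /chain_boundary /= addbb.
  move=> f g [c [cs ct cxy cb]] /He [u [v [uv ntu duv nuv]]].
  exists (fun a b => c a b (+) edge_chain u v a b); split.
  - by move=> a b; rewrite cs ecs.
  - by move=> a b tab; rewrite ct // ect.
  - rewrite cxy /=; apply: contraNF nuv => /orP[] /andP[/eqP-> /eqP->].
      by rewrite /edge_chain !eqxx.
    by rewrite /edge_chain !eqxx orbT.
  - move=> i j hi hj; rewrite cbD cb // chain_boundary_edge //.
    by case/orP: duv => /andP[/eqP-> /eqP->]; do 3!case: (_ == _).
have : c x y (+) edge_chain x y x y = false.
  apply: (@chain_zero (fun a b => c a b (+) edge_chain x y a b)) => //.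
  - by move=> a b; rewrite cs ecs.
  - by move=> a b tab; rewrite ct // ect.
  - by move=> i j hi hj; rewrite cbD cb // chain_boundary_edge // addbb.
by rewrite cxy /edge_chain !eqxx.
Qed.

Lemma face_corners t : (exists i j, t = face i j) ->
  t = None \/ exists q : 'I_4 -> gpoint, forall a, t \in faces_at a ->
    exists b, q b = a.
Proof.
move=> [i [j ->]]; case Ef : (face i j) => [p|]; last by left.
move: Ef; rewrite {1}/face; case: ifP => //.
case/andP=> /andP[i0 hi] /andP[j0 hj] [<-].
(* The two binary digits of [b] choose the row and the column of the corner. *)
right; exists (fun b : 'I_4 => pt (if b < 2 then i else i.-1)
                                (if odd b then j else j.-1)) => a.
have la1 := coord1_le a; have la2 := coord2_le a.
have in_face k l : Some (pt i j) = face k l -> k = i /\ l = j.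
  rewrite /face; case: ifP => // /andP[/andP[_ hk] /andP[_ hl]] [].
  move=> /(congr1 val) + /(congr1 val).
  by rewrite /= !inordK.
have found (b : nat) : b < 4 -> pt (if b < 2 then i else i.-1)
    (if odd b then j else j.-1) = a -> exists b : 'I_4,
    pt (if b < 2 then i else i.-1) (if odd b then j else j.-1) = a.
  by move=> hb E; exists (Ordinal hb).
rewrite /faces_at !inE => /or4P[] /eqP/in_face[] E1 E2.
- by apply: (found 1) => //=; rewrite -E1 -E2 ptE.
- by apply: (found 3) => //=; rewrite -E1 -E2 ptE.
- by apply: (found 0) => //=; rewrite -E1 -E2 ptE.
- by apply: (found 2) => //=; rewrite -E1 -E2 ptE.
Qed.

(** * Separators of a graph whose vertices colour the grid *)

Section Coloring.

Variables (V : finType) (e : rel V) (tp : V -> V) (phi : gpoint -> V).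
Hypothesis phi_par :
  forall z, phi (par z) = phi z \/ phi (par z) = tp (phi z).
Hypothesis phi_fiber : forall x y, phi x = phi y ->
  connect (restr_rel gadj (fun z => phi z == phi x)) x y.
Hypothesis phi_edge : forall v w, e v w -> v != w ->
  exists x y, [/\ gadj x y, phi x = v & phi y = w].
Hypothesis phi_surj : forall v, exists x, phi x = v.
Variable v0 : V.
Hypothesis phi_outer : forall x, None \in faces_at x -> phi x = v0.

Definition face_paths (t : option gpoint) : pred V :=
  fun v => [exists a, (t \in faces_at a) && fconnect tp (phi a) v].

(** By [phi_par], a step to the parent in the grid either keeps the vertex or moves to its parent,
    so grid tree paths project into tree paths of the graph. *)
Lemma corner_below_paths t z : corner_below t z -> face_paths t (phi z).
Proof.
case/existsP=> a /andP[ta az]; apply/existsP; exists a; rewrite ta /=.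
move: az; apply: (connect_closed (P := fun z => fconnect tp (phi a) (phi z))).
  exact: connect0.
move=> u w au /eqP <-; case: (phi_par u) => -> //.
exact: connect_trans au (fconnect1 _ _).
Qed.

Lemma face_paths_corner t x : t \in faces_at x -> face_paths t (phi x).
Proof. by move=> tx; apply/existsP; exists x; rewrite tx connect0. Qed.

Lemma fiber_faces t x y f g : ~~ face_paths t (phi x) -> phi x = phi y ->
  f \in faces_at x -> g \in faces_at y -> connect (cotree_off t) f g.
Proof.
move=> nt xy fx; have nz z : phi z = phi x -> ~~ corner_below t z.
  by move=> zx; apply: contra nt; rewrite -zx; exact: corner_below_paths.
move: (phi_fiber xy) g.
apply: (connect_closed (P := fun z => forall g, g \in faces_at z ->
  connect (cotree_off t) f g)).
  by move=> g; apply: faces_at_same fx; exact: nz.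
move=> u w IH /and3P[uw /eqP ux /eqP wx] g gw.
have [s _] := side_faces_at uw; have := IH _ s => /connect_trans; apply.
move: gw; apply: faces_at_same; first exact: nz.
by move: uw; rewrite gadj_sym side1C => /side_faces_at[].
Qed.

(** Consequently a connected set of vertices avoiding the paths of [t] touches only one branch of
    the cotree at [t]. *)
Lemma adj_faces t u w x y f g : ~~ face_paths t u -> ~~ face_paths t w ->
  e u w -> phi x = u -> phi y = w -> f \in faces_at x -> g \in faces_at y ->
  connect (cotree_off t) f g.
Proof.
move=> nu nw uw xu yw fx gy; case: (eqVneq u w) => [E|nuw].
  by apply: fiber_faces fx gy; rewrite ?xu ?yw.
have [x' [y' [xy' xu' yw']]] := phi_edge uw nuw.
have [s _] := side_faces_at xy'.
apply: (@connect_trans _ _ (side1 x' y')).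
  by apply: fiber_faces fx s; rewrite ?xu ?xu'.
have s' : side1 x' y' \in faces_at y'.
  by move: xy'; rewrite gadj_sym side1C => /side_faces_at[].
by apply: fiber_faces s' gy; rewrite ?yw ?yw'.
Qed.

Lemma majority_meet (B B' W : pred V) :
  {subset B <= W} -> {subset B' <= W} ->
  #|W| < 2 * #|B| -> #|W| < 2 * #|B'| -> exists w, B w /\ B' w.
Proof.
move=> BW BW' hB hB'; case: (pickP (predI B B')) => [w /andP[]|no].
  by exists w.
have := cardUI B B'; rewrite (eq_card0 (A := [predI B & B'])) // => E.
have : #|[predU B & B']| <= #|W|.
  by apply/subset_leq_card/subsetP => w /orP[/BW|/BW'].
by move: E hB hB'; clear; lia.
Qed.

(* Among all pairs of a face and a majority component next to it, take one with
   the smallest component and step across the edge leading into it. *)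
Lemma grid_separator (W : pred V) : exists U : 'I_4 -> V,
  let A : pred V := fun v => [forall b, ~~ fconnect tp (U b) v] in
  forall v, A v ->
    2 * #|[pred w | W w && connect (restr_rel e A) v w]| <= #|W|.
Proof.
have [rep repP] := fin_all_exists phi_surj.
pose g v := face (rep v).1 (rep v).2.
have gin v : g v \in faces_at (rep v) by rewrite /g /faces_at inE eqxx.
(* [K t v] is the branch at [t] that touches [v], and [B t v] the part of [W] lying in it. A pair is
   [bad] when that part is a strict majority of [W]; a face in no bad pair is balanced. *)
pose K t v : pred (option gpoint) := connect (cotree_off t) (g v).
pose B t v : pred V :=
  [pred w | [&& W w, ~~ face_paths t w & K t v (g w)]].
pose isf t := [exists x, t \in faces_at x].
pose bad (p : option gpoint * V) :=
  [&& isf p.1, ~~ face_paths p.1 p.2 & #|W| < 2 * #|B p.1 p.2|].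
have isfP t : isf t -> exists i j, t = face i j.
  by case/existsP=> x; rewrite !inE => /or4P[] /eqP->;
     [exists x.1, x.2 | exists x.1.+1, x.2 | exists x.1, x.2.+1
     | exists x.1.+1, x.2.+1].
case: (boolP [exists t, isf t && [forall v, ~~ bad (t, v)]]).
  case/existsP=> t /andP[ft /forallP good].
  have [U UP] : exists U : 'I_4 -> V, forall v,
      face_paths t v -> exists b, fconnect tp (U b) v.
    have [E|[q qP]] := face_corners (isfP _ ft).
      (* All corners of the outer face have the colour [v0], so its four paths coincide. *)
      exists (fun _ => v0) => v /existsP[a /andP[ta av]]; exists ord0.
      by move: ta av; rewrite E => /phi_outer ->.
    exists (phi \o q) => v /existsP[a /andP[/qP[b <-] av]]; by exists b.
  exists U => A v Av.
  have nA w : A w -> ~~ face_paths t w.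
    by move=> /forallP Aw; apply/negP => /UP[b]; apply/negP/Aw.
  have := good v; rewrite /bad /= ft nA //= -leqNgt; apply: leq_trans.
  rewrite leq_mul2l /=; apply/subset_leq_card/subsetP => w /andP[Ww vw].
  rewrite !inE Ww nA ?(restr_connect_in vw) //=.
  have : A w /\ K t v (g w).
    apply: (connect_closed (P := fun w => A w /\ K t v (g w))) vw.
      by split; last exact: connect0.
    move=> u z [Au Ku] /and3P[uz _ Az]; split=> //.
    by apply: connect_trans Ku _; apply: adj_faces uz _ _ _ _;
       rewrite ?nA ?repP ?gin.
  by case.
move=> nogood; have badE t : isf t -> exists v, bad (t, v).
  move=> ft; apply/existsP; apply: contraNT nogood => /existsPn H.
  by apply/existsP; exists t; rewrite ft; apply/forallP.
have [p0 bp0] : exists p, bad p.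
  have fN : isf None.
    by apply/existsP; exists (pt 0 0); rewrite /faces_at pt1 // pt2 // inE.
  by have [v bv] := badE _ fN; exists (None, v).
have [[t v] /and3P[/= ft nv majv] minK] :=
  @arg_minnP _ p0 bad (fun p => #|K p.1 p.2|) bp0.
have gvt : g v != t.
  apply: contra nv => /eqP gt; rewrite -[v]repP; apply: face_paths_corner.
  by rewrite -gt gin.
have Kt f : K t v f -> f != t by move=> /restr_connect_in; exact.
have gt : connect cotree (g v) t.
  have [i [j ->]] := isfP _ ft.
  apply: connect_trans (cotree_connected i j).
  by rewrite (sym_connect_sym cotree_sym) cotree_connected.
(* A cotree walk from the face of [v] to [t] has to leave the branch, which is possible only through
   [t]; [t'] is the face of the branch just before. *)
have [t' [h [t'h Kt' nKh]]] :
    exists t' h, [/\ cotree t' h, K t v t' & ~~ K t v h].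
  apply: connect_exit gt _ _; first exact: connect0.
  by apply: contraT; rewrite negbK => /Kt; rewrite eqxx.
have {h nKh t'h}t't : cotree t' t.
  case: (eqVneq h t) => [<- //|ht]; case/negP: nKh.
  apply: (connect_trans Kt' (connect1 _)).
  by rewrite /cotree_off /restr_rel /= t'h ht (Kt _ Kt').
have [x [y [xy nxy dxy]]] := cotreeP _ _ t't.
have ft' : isf t' by apply/existsP; exists x; exact: dual_edge_faces dxy.
have [v' bv'] := badE _ ft'; have /and3P[/= _ nv' majv'] := bv'.
have [w [/and3P[_ nw Kw] /and3P[_ nw' Kw']]] :
    exists w, B t v w /\ B t' v' w.
  by apply: majority_meet majv majv' => w /and3P[].
have swap s u f f' : K s u f -> K s u f' -> connect (cotree_off s) f f'.
  by move=> Kf; apply: connect_trans; rewrite cotree_off_connectC.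
(* If the majority branch at [t'] contained [t], then [t'] would reach the face of the common vertex
   [w] off [t], and that face would reach [t] off [t']. This joins the two sides of the bridge xy
   without crossing it. Otherwise the branch at [t'] lies inside the branch at [t] and misses [t'],
   against minimality. *)
case: (boolP (K t' v' t)) => K't.
  pose del f f' := cotree_off t f f' || cotree_off t' f f'.
  have del_sym : symmetric del.
    move=> f f'.
    by rewrite /del cotree_off_sym [cotree_off t' _ _]cotree_off_sym.
  have con : connect del t' t.
    apply: (@connect_trans _ _ (g w)).
      apply: (connect_sub _ (swap _ _ _ _ Kt' Kw)) => f f' ff'.
      by apply: connect1; rewrite /del ff'.
    apply: (connect_sub _ (swap _ _ _ _ Kw' K't)) => f f' ff'.
    by apply: connect1; rewrite /del ff' orbT.
  have : ~~ connect del (side1 x y) (side2 x y).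
    apply: cotree_bridge => // f f' ff'.
    have cff' : cotree f f' by case/orP: ff' => /and3P[].
    have [u [z [uz nuz duz]]] := cotreeP _ _ cff'.
    exists u, z; split=> //; apply/negP => xyuz.
    have {duz}dff' : dual_edge x y f f'.
      case/orP: xyuz => /andP[/eqP Eu /eqP Ez]; move: duz; rewrite Eu Ez //.
      by rewrite /dual_edge side1C side2C // gadj_sym.
    move: ff'; rewrite /del /cotree_off /restr_rel /=.
    case/orP: dxy => /andP[/eqP-> /eqP->];
    case/orP: dff' => /andP[/eqP-> /eqP->];
    by rewrite !eqxx ?andbF ?andFb.
  case/orP: dxy => /andP[/eqP <- /eqP <-]; first by rewrite con.
  by rewrite (sym_connect_sym del_sym) con.
have := minK _ bv'; rewrite leqNgt => /negP[]; apply: proper_card.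
apply/properP; split; last first.
  exists t'; first exact: Kt'.
  apply/negP => /restr_connect_in /(_ _)/negP[]; last by rewrite /= eqxx.
  apply: contra nv' => /= /eqP gt'; rewrite -[v']repP; apply: face_paths_corner.
  by rewrite -gt' gin.
apply/subsetP => f K'f.
have : K t' v' f /\ K t v f.
  apply: (connect_closed (P := fun f => K t' v' f /\ K t v f))
           (swap _ _ _ _ Kw' K'f) => // u z [K'u Ku] uz.
  have K'z : K t' v' z by exact: connect_trans K'u (connect1 uz).
  split=> //; apply: (connect_trans Ku (connect1 _)).
  case/and3P: uz => uz _ _; rewrite /cotree_off /restr_rel /= uz (Kt _ Ku) /=.
  by apply: contra K't => /eqP <-.
by case.
Qed.

End Coloring.

End GridTree.

End Grid.
(* Planarity, in the form used here: the graph is obtained from a square grid by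
   contracting connected sets of points, and deleting edges. *)
Record grid_model (V : finType) (e : rel V) (n : nat)
    (phi : 'I_n.+1 * 'I_n.+1 -> V) : Prop := GridModel {
  model_fiber : forall x y, phi x = phi y ->
    connect (restr_rel (@gadj n) (fun z => phi z == phi x)) x y;
  model_edge : forall v w, e v w -> v != w ->
    exists x y, [/\ gadj x y, phi x = v & phi y = w];
  model_surj : forall v, exists x, phi x = v;
  model_outer : exists v0, forall x, None \in faces_at x -> phi x = v0
}.

(** * Lifting the breadth-first tree of the graph to the grid *)

Section Separator.

Variables (V : finType) (e : rel V) (c : V) (tp : V -> V).
Hypothesis tp_parent : forall x, x != c ->
  e (tp x) x /\ gdist e c x = (gdist e c (tp x)).+1.

(** From a point over [c], every point is reached by steps that stay over one vertex or pass from
    [tp v] to [v]: fibres are connected and tree edges are realised. A breadth-first tree of these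
    steps has the required projection. *)
Lemma lift_tree n phi : @grid_model V e n phi -> exists r par (rk : _ -> nat),
  [/\ par r = r, forall z, z != r -> gadj (par z) z,
      forall z, z != r -> rk (par z) < rk z &
      forall z, phi (par z) = phi z \/ phi (par z) = tp (phi z)].
Proof.
case=> fib edge surj _; have [r rc] := surj c.
pose down : rel _ := fun y x : 'I_n.+1 * 'I_n.+1 =>
  gadj y x && ((phi y == phi x) || (phi y == tp (phi x))).
have down_fib x y : phi x = phi y -> connect down x y.
  move=> /fib; apply: connect_sub => u w /and3P[uw /eqP ux /eqP wx].
  by apply: connect1; rewrite /down uw ux wx eqxx.
have reach m : forall x, gdist e c (phi x) <= m -> connect down r x.
  elim: m => [|m IH] x hx; case: (eqVneq (phi x) c) => [xc|xc];
    try by apply: down_fib; rewrite rc.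
    by have [_ E] := tp_parent xc; rewrite E in hx.
  have [ex E] := tp_parent xc.
  have nx : tp (phi x) != phi x.
    by apply/eqP => E'; move: E; rewrite E' => /eqP; rewrite eqn_leq ltnn andbF.
  have [y [z [yz Ey Ez]]] := edge _ _ ex nx.
  apply: (@connect_trans _ _ y); first by apply: IH; rewrite Ey -ltnS -E.
  apply: (@connect_trans _ _ z); last exact: down_fib.
  by apply: connect1; rewrite /down yz Ey Ez eqxx orbT.
have [par [par0 parP]] := bfs_parent (fun x => reach _ x (leqnn _)).
exists r, par, (gdist down r); split=> // z.
- by move=> /parP[/andP[]].
- by move=> /parP[_ ->].
case: (eqVneq z r) => [->|/parP[/andP[_ /orP[] /eqP->] _]];
  rewrite ?par0; by [left|right].
Qed.

Lemma planar_separator n phi (W : pred V) : @grid_model V e n phi ->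
  exists U : 'I_4 -> V,
  let A : pred V := fun v => [forall b, ~~ fconnect tp (U b) v] in
  forall v, A v ->
    2 * #|[pred w | W w && connect (restr_rel e A) v w]| <= #|W|.
Proof.
move=> M; have [r [par [rk [pr pa pk pp]]]] := lift_tree M.
case: M => fib edge surj [v0 outer].
exact: (grid_separator pr pa pk pp fib edge surj outer).
Qed.

End Separator.

(** * Grid models from rounded arcs *)

Section Lines.

Variable n : nat.
Local Notation gpoint := ('I_n.+1 * 'I_n.+1)%type.
Variable A : pred gpoint.
Local Notation rA := (restr_rel (@gadj n) A).

Lemma restr_gadj_sym : symmetric rA.
Proof. exact/restr_rel_sym/gadj_sym. Qed.

Lemma restr_gadjC : connect_sym rA.
Proof. exact/sym_connect_sym/restr_gadj_sym. Qed.

Lemma connect_row i j : i <= n -> j <= n ->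
  (forall a, a <= i -> A (pt n a j)) -> connect rA (pt n 0 j) (pt n i j).
Proof.
elim: i => [|i IH] hi hj H; first exact: connect0.
apply: connect_trans (IH (ltnW hi) hj _) (connect1 _) => [a ha|].
  by apply: H; exact: leqW.
by rewrite /restr_rel gadj_right // !H.
Qed.

Lemma connect_col i j : i <= n -> j <= n ->
  (forall b, b <= j -> A (pt n i b)) -> connect rA (pt n i 0) (pt n i j).
Proof.
elim: j => [|j IH] hi hj H; first exact: connect0.
apply: connect_trans (IH hi (ltnW hj) _) (connect1 _) => [b hb|].
  by apply: H; exact: leqW.
by rewrite /restr_rel gadj_up // !H.
Qed.

Definition near1 (a b : nat) := (a <= b.+1) && (b <= a.+1).

(** The 3 by 3 block around [q]. Consecutive samples may differ diagonally; blocks make the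
    thickened arc connected in the grid. *)
Definition inbox (q : nat * nat) (p : gpoint) := near1 q.1 p.1 && near1 q.2 p.2.

Lemma box_connect (q : nat * nat) p : 0 < q.1 < n -> 0 < q.2 < n ->
  (forall p, inbox q p -> A p) -> inbox q p -> connect rA (pt n q.1 q.2) p.
Proof.
move=> /andP[a0 an] /andP[b0 bn] H pq.
have step x y : inbox q x -> inbox q y -> x = y \/ gadj x y -> connect rA x y.
  move=> qx qy [->|xy]; first exact: connect0.
  by apply: connect1; rewrite /restr_rel xy !H.
have lp1 := coord1_le p; have lp2 := coord2_le p.
have qa : inbox q (pt n q.1 q.2).
  rewrite /inbox /near1 pt1 ?pt2 ?(ltnW an) ?(ltnW bn) //.
  by rewrite !leqnSn.
have qb : inbox q (pt n p.1 q.2).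
  rewrite /inbox /near1 pt1 ?pt2 ?(ltnW bn) // !leqnSn !andbT.
  by case/andP: pq.
apply: (@connect_trans _ _ (pt n p.1 q.2)); apply: step => //.
  case/andP: pq; rewrite /near1 => /andP[h1 h2] _.
  case: (ltngtP (p.1 : nat) q.1) => [lt|gt|->]; last by left.
    have -> : q.1 = p.1.+1 by apply/eqP; rewrite eqn_leq h1.
    right; rewrite gadj_sym gadj_right ?(ltnW bn) //.
    exact: ltn_trans lt an.
  have Ep : p.1 = q.1.+1 :> nat by apply/eqP; rewrite eqn_leq h2.
  by right; rewrite Ep gadj_right ?(ltnW bn) // -Ep.
suff : pt n p.1 q.2 = pt n p.1 p.2 \/ gadj (pt n p.1 q.2) (pt n p.1 p.2).
  by rewrite ptE.
case/andP: pq => _; rewrite /near1 => /andP[h1 h2].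
case: (ltngtP (p.2 : nat) q.2) => [lt|gt|->]; last by left.
  have -> : q.2 = p.2.+1 by apply/eqP; rewrite eqn_leq h1.
  right; rewrite gadj_sym gadj_up //; exact: ltn_trans lt bn.
have Ep : p.2 = q.2.+1 :> nat by apply/eqP; rewrite eqn_leq h2.
by right; rewrite Ep gadj_up // -Ep.
Qed.

Lemma box_chain (f : nat -> nat * nat) L :
  (forall k, k <= L -> (0 < (f k).1 < n) && (0 < (f k).2 < n)) ->
  (forall k, k < L -> near1 (f k).1 (f k.+1).1 && near1 (f k).2 (f k.+1).2) ->
  (forall k p, k <= L -> inbox (f k) p -> A p) ->
  forall k, k <= L -> connect rA (pt n (f 0).1 (f 0).2) (pt n (f k).1 (f k).2).
Proof.
move=> rng st HA; elim=> [|k IH] hk; first exact: connect0.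
apply: connect_trans (IH (ltnW hk)) _.
have /andP[r1 r2] := rng k (ltnW hk).
have /andP[/andP[_ r3] /andP[_ r4]] := rng k.+1 hk.
apply: box_connect => // [p|]; first exact/HA/ltnW.
by rewrite /inbox pt1 ?pt2 ?st // ltnW.
Qed.

End Lines.

Lemma gadj_connected n (x y : 'I_n.+1 * 'I_n.+1) : connect (@gadj n) x y.
Proof.
have sub z w : connect (restr_rel (@gadj n) xpredT) z w ->
    connect (@gadj n) z w.
  by apply: connect_sub => a b /and3P[ab _ _]; exact: connect1.
have from0 z : connect (@gadj n) (pt n 0 0) z.
  have l1 := coord1_le z; have l2 := coord2_le z.
  apply: (@connect_trans _ _ (pt n z.1 0)); apply: sub.
    exact: connect_row.
  by rewrite -[X in connect _ _ X]ptE; exact: connect_col.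
apply: connect_trans (from0 y).
by rewrite (sym_connect_sym (@gadj_sym n)).
Qed.

Definition near2 (a b : nat) := (a <= b.+2) && (b <= a.+2).

Definition boxes_meet (q q' : nat * nat) := near2 q.1 q'.1 && near2 q.2 q'.2.

Lemma inbox_meet n (q q' : nat * nat) (p : 'I_n.+1 * 'I_n.+1) :
  inbox q p -> inbox q' p -> boxes_meet q q'.
Proof. by rewrite /inbox /boxes_meet /near1 /near2; clear; lia. Qed.

(** * Regions of the vertices built from sampled arcs *)

Section Samples.

Variables (V : finType) (e : rel V) (m n : nat).
Variable g : V -> V -> nat -> nat * nat.
Hypothesis e_sym : symmetric e.

Definition proper_edge (v w : V) := e v w && (v != w).

(* g v w 0, ..., g v w (3 * m) are consecutive samples of the arc from v to w,
   rounded to the grid (or all equal to the vertex v if there is no such arc).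
   The samples up to m belong to v, those from m to 2 * m are shared. *)
Hypothesis g_range : forall v w k, k <= 3 * m ->
  (1 < (g v w k).1 < n.-1) && (1 < (g v w k).2 < n.-1).
Hypothesis g_step : forall v w k, k < 3 * m ->
  near1 (g v w k).1 (g v w k.+1).1 && near1 (g v w k).2 (g v w k.+1).2.
Hypothesis g_base : forall v w, g v w 0 = g v v 0.
Hypothesis g_rev : forall v w k, proper_edge v w -> k <= 3 * m ->
  g w v k = g v w (3 * m - k).
Hypothesis g_stars : forall v w x y k l, v != x -> k <= m -> l <= m ->
  ~~ boxes_meet (g v w k) (g x y l).
Hypothesis g_middles : forall v w x y k l, proper_edge v w -> proper_edge x y ->
  ~~ ((v == x) && (w == y) || (v == y) && (w == x)) ->
  m <= k <= 2 * m -> m <= l <= 2 * m -> ~~ boxes_meet (g v w k) (g x y l).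
Hypothesis g_middle_star : forall v w z y k l,
  proper_edge v w -> z != v -> z != w ->
  m <= k <= 2 * m -> l <= m -> ~~ boxes_meet (g v w k) (g z y l).

Local Notation gpoint := ('I_n.+1 * 'I_n.+1)%type.

Definition star (v : V) : pred gpoint :=
  fun p => [exists w, exists k : 'I_m.+1, inbox (g v w k) p].
Definition middle (v w : V) : pred gpoint :=
  fun p => [exists k : 'I_m.+1, inbox (g v w (m + k)) p].
Definition owns (v w : V) := proper_edge v w && (enum_rank v < enum_rank w).
(** Each middle third goes to the end of smaller rank, but it also runs into the star at the other
    end, so foreign stars are removed. This may cut the zone, and [core] keeps the component of the
    base point. *)
Definition zone (v : V) : pred gpoint := fun p =>
  (star v p || [exists w, owns v w && middle v w p]) &&
  [forall z, (z != v) ==> ~~ star z p].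
Definition base (v : V) : gpoint := pt n (g v v 0).1 (g v v 0).2.
Definition core (v : V) : pred gpoint :=
  connect (restr_rel (@gadj n) (zone v)) (base v).

Lemma starP v p :
  reflect (exists w k, k <= m /\ inbox (g v w k) p) (star v p).
Proof.
apply: (iffP existsP) => [[w /existsP[k kp]]|[w [k [km kp]]]].
  by exists w, k; rewrite -ltnS ltn_ord.
by exists w; apply/existsP; exists (Ordinal (km : k < m.+1)).
Qed.

Lemma middleP v w p :
  reflect (exists k, m <= k <= 2 * m /\ inbox (g v w k) p) (middle v w p).
Proof.
apply: (iffP existsP) => [[k kp]|[k [/andP[mk km] kp]]].
  exists (m + k); rewrite leq_addr mul2n -addnn leq_add2l.
  by rewrite -ltnS ltn_ord.
have h : k - m < m.+1 by rewrite ltnS leq_subLR addnn -mul2n.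
by exists (Ordinal h); rewrite /= subnKC.
Qed.

Lemma star_disjoint v w p : star v p -> star w p -> v = w.
Proof.
case/starP=> a [k [km kp]] /starP[b [l [lm lp]]].
apply/eqP; apply: contraT => vw.
by have := g_stars a b vw km lm; rewrite (inbox_meet kp lp).
Qed.

Lemma star_zone v p : star v p -> zone v p.
Proof.
move=> vp; rewrite /zone vp /=; apply/forallP => z; apply/implyP.
by apply: contra => zp; apply/eqP; exact: star_disjoint zp vp.
Qed.

Lemma g_rangeW v w k : k <= 3 * m ->
  (0 < (g v w k).1 < n) && (0 < (g v w k).2 < n).
Proof. by move=> /(g_range v w); clear; lia. Qed.

Lemma star_core v p : star v p -> core v p.
Proof.
case/starP=> w [k [km kp]]; rewrite /core /base -(g_base v w).
have le3 l : l <= m -> l <= 3 * m.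
  by move=> /leq_trans; apply; rewrite leq_pmull.
have inz l x : l <= m -> inbox (g v w l) x -> zone v x.
  by move=> lm lx; apply/star_zone/starP; exists w, l.
apply: (@connect_trans _ _ (pt n (g v w k).1 (g v w k).2)).
  apply: (box_chain (f := g v w) (L := m)) => //.
  - by move=> l /le3; exact: g_rangeW.
  - by move=> l lm; apply: g_step; apply: leq_trans lm _; rewrite leq_pmull.
have /andP[r1 r2] := g_rangeW v w (le3 _ km).
by apply: box_connect => // x; exact: inz.
Qed.

Lemma base_star v : star v (base v).
Proof.
have /andP[/andP[_ r1] /andP[_ r2]] := g_rangeW v v (leq0n (3 * m)).
apply/starP; exists v, 0; split=> //.
by rewrite /inbox /base /near1 pt1 ?pt2 ?leqnSn // ltnW.
Qed.

Lemma core_zone v p : core v p -> zone v p.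
Proof. by move=> /restr_connect_in; apply; exact/star_zone/base_star. Qed.

Lemma zone_disjoint v w p : zone v p -> zone w p -> v = w.
Proof.
case/andP=> Av /forallP nv /andP[Aw /forallP nw]; apply/eqP/contraT => vw.
have nvp : ~~ star v p by have := nw v; rewrite vw.
have nwp : ~~ star w p by have := nv w; rewrite eq_sym vw.
move: Av Aw; rewrite (negbTE nvp) (negbTE nwp) /=.
case/existsP=> a /andP[/andP[va rva] /middleP[k [km kp]]].
case/existsP=> b /andP[/andP[wb rwb] /middleP[l [lm lp]]].
have vawb : ~~ ((v == w) && (a == b) || (v == b) && (a == w)).
  rewrite (negbTE vw) /=; apply/negP => /andP[/eqP vb /eqP aw].
  by move: rwb; rewrite -aw -vb => /(ltn_trans rva); rewrite ltnn.
by have := g_middles va wb vawb km lm; rewrite (inbox_meet kp lp).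
Qed.

Lemma core_disjoint v w p : core v p -> core w p -> v = w.
Proof. by move=> /core_zone vp /core_zone; exact: zone_disjoint. Qed.

Lemma core_step v p q : core v p -> gadj p q -> zone v q -> core v q.
Proof.
move=> vp pq vq; apply: (connect_trans vp (connect1 _)).
by rewrite /restr_rel pq vq core_zone.
Qed.

(** Let [v] own the arc. The blocks along it lead from the core of [v] to the base of [w]; consider
    the first point outside the core. It is not in the star of [v], and were it in the middle third
    but not in the star of [w], it would still belong to the zone of [v]. So it lies in the star of
    [w]. *)
Lemma core_edge v w : proper_edge v w ->
  exists x y, [/\ gadj x y, core v x & core w y].
Proof.
wlog rvw : v w / enum_rank v < enum_rank w.
  move=> H vw; have nvw : v != w by case/andP: vw.
  case: (ltngtP (enum_rank v) (enum_rank w)) => [/H|/H|].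
  - exact.
  - rewrite /proper_edge e_sym eq_sym; move/(_ vw) => [x [y [xy wx vy]]].
    by exists y, x; rewrite gadj_sym.
  - by move=> /val_inj/enum_rank_inj E; rewrite E eqxx in nvw.
move=> vw; pose A p := [|| star v p, middle v w p | star w p].
have con : connect (restr_rel (@gadj n) A) (base v) (base w).
  have -> : base w = pt n (g v w (3 * m)).1 (g v w (3 * m)).2.
    by rewrite /base -(g_base w v) g_rev // subn0.
  rewrite /base -(g_base v w).
  apply: (box_chain (f := g v w) (L := 3 * m)) => //.
  - by move=> l; exact: g_rangeW.
  - by move=> l; exact: g_step.
  move=> k p k3 kp; rewrite /A; case: (leqP k m) => km.
    by apply/orP; left; apply/starP; exists w, k.
  case: (leqP k (2 * m)) => k2.
    rewrite orbA orbC orbA; apply/orP; right.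
    by apply/middleP; exists k; rewrite ltnW.
  rewrite !orbA; apply/orP; right; apply/starP; exists v, (3 * m - k).
  have h : 3 * m - k <= m by move: k2; clear; lia.
  by rewrite h g_rev ?leq_subr // subKn.
have nw : ~~ core v (base w).
  apply/negP => /core_disjoint /(_ (star_core (base_star w))) E.
  by case/andP: vw; rewrite E eqxx.
have [x [y [/and3P[xy Ax Ay] vx nvy]]] := connect_exit con (connect0 _ _) nw.
exists x, y; split=> //; case/or3P: Ay => [/star_core vy|vwy|/star_core //].
  by case/negP: nvy.
case: (boolP (star w y)) => [/star_core //|nwy].
case/negP: nvy; apply: core_step vx xy _.
apply/andP; split.
  by apply/orP; right; apply/existsP; exists w; rewrite /owns vw rvw.
apply/forallP => z; apply/implyP => zv.
case: (eqVneq z w) => [-> //|zw].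
apply/negP => /starP[u [l [lm lp]]]; case/middleP: vwy => k [km kp].
by have := g_middle_star u vw zv zw km lm; rewrite (inbox_meet kp lp).
Qed.

Definition unclaimed : pred gpoint := fun p => [forall v, ~~ core v p].
Local Notation unclaimed_rel := (restr_rel (@gadj n) unclaimed).

Variable v0 : V.

(* A whole component of unclaimed points is given to one adjacent core. *)
Definition owner (p : gpoint) : V :=
  if [pick v | core v p] is Some v then v else
  odflt v0 [pick v | [exists a, exists q,
    [&& connect unclaimed_rel (root unclaimed_rel p) a, gadj a q & core v q]]].

Lemma unclaimedC : connect_sym unclaimed_rel.
Proof. exact: restr_gadjC. Qed.

Lemma owner_core v p : core v p -> owner p = v.
Proof.
move=> vp; rewrite /owner; case: pickP => [w wp|/(_ v)]; last by rewrite vp.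
exact: core_disjoint wp vp.
Qed.

Lemma owner_unclaimed p : unclaimed p -> exists a q,
  [/\ connect unclaimed_rel p a, gadj a q & core (owner p) q].
Proof.
move=> up; rewrite /owner; case: pickP => [v|_].
  by move/forallP: up => /(_ v)/negbTE ->.
case: pickP => [v /existsP[a /existsP[q /and3P[pa aq vq]]]|no] /=.
  by exists a, q; split=> //; apply: connect_trans pa; exact: connect_root.
have nb : ~~ connect unclaimed_rel p (base v0).
  apply/negP => /restr_connect_in/(_ up)/forallP/(_ v0)/negP; apply.
  exact/star_core/base_star.
have [a [q [aq pa npq]]] :=
  connect_exit (gadj_connected p (base v0)) (connect0 unclaimed_rel p) nb.
have ua := restr_connect_in pa up.
case: (boolP (unclaimed q)) => [uq|].
  case/negP: npq; apply: (connect_trans pa (connect1 _)).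
  by rewrite /restr_rel aq ua uq.
case/forallPn => v; rewrite negbK => vq.
have /negbT/negP[] := no v; apply/existsP; exists a; apply/existsP; exists q.
rewrite aq vq !andbT; apply: connect_trans pa.
by rewrite unclaimedC connect_root.
Qed.

Lemma owner_component p q : unclaimed p -> connect unclaimed_rel p q ->
  owner q = owner p.
Proof.
move=> up pq; have uq := restr_connect_in pq up.
have none z : unclaimed z -> [pick v | core v z] = None.
  move=> /forallP uz; case: pickP => // v vz.
  by have := uz v; rewrite vz.
by rewrite /owner !none // (rootP unclaimedC pq).
Qed.

(** Fibres are connected: a core is connected by construction, and an unclaimed component touches
    the core it is given to. *)
Lemma owner_base p : connect
  (restr_rel (@gadj n) (fun z => owner z == owner p)) (base (owner p)) p.
Proof.
have core_con v q : core v q ->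
    connect (restr_rel (@gadj n) (fun z => owner z == v)) (base v) q.
  move=> vq; apply: (@restr_connectS _ _ (core v)).
    by move=> z /owner_core ->.
  apply: connect_restr vq; last exact: connect0.
  move=> a b va ab; have /and3P[ab' _ zb] := ab; split=> //.
  exact: core_step va ab' zb.
case: (boolP (unclaimed p)) => [up|]; last first.
  by case/forallPn=> v; rewrite negbK => vp; rewrite (owner_core vp) core_con.
have [a [q [pa aq vq]]] := owner_unclaimed up.
apply: connect_trans (core_con _ _ vq) _; rewrite restr_gadjC.
apply: (@connect_trans _ _ a).
  apply: (@restr_connectS _ _ (connect unclaimed_rel p)).
    by move=> z pz; rewrite (owner_component up pz).
  apply: connect_restr pa; last exact: connect0.
  move=> x y px xy; split; first by case/and3P: xy.
  exact: connect_trans px (connect1 xy).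
apply: connect1; rewrite /restr_rel aq (owner_component up pa) eqxx /=.
by rewrite (owner_core vq).
Qed.

Lemma range_n : 2 < n.
Proof.
have /andP[/andP[]] := g_range v0 v0 (leq0n (3 * m)); clear; lia.
Qed.

Lemma core_inner v p : core v p -> (0 < p.1 < n) && (0 < p.2 < n).
Proof.
have box w k : k <= 3 * m -> inbox (g v w k) p ->
    (0 < p.1 < n) && (0 < p.2 < n).
  move=> /(g_range v w) /andP[/andP[h1 h2] /andP[h3 h4]].
  rewrite /inbox /near1 => /andP[/andP[h5 h6] /andP[h7 h8]].
  move: h1 h2 h3 h4 h5 h6 h7 h8; clear; lia.
move=> /core_zone /andP[/orP[|] H _].
  have /starP[w [k [km kp]]] := H; apply: box kp.
  by apply: leq_trans km _; rewrite leq_pmull.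
have /existsP[w /andP[_ /middleP[k [/andP[_ km] kp]]]] := H; apply: box kp.
by apply: leq_trans km _; rewrite leq_mul2r orbT.
Qed.

Lemma samples_model : grid_model e owner.
Proof.
have n_gt2 := range_n.
split=> [x y xy|v w vw nvw|v|].
- apply: (@connect_trans _ _ (base (owner x))).
    by rewrite restr_gadjC owner_base.
  by have := owner_base y; rewrite -xy.
- have [x [y [xy vx wy]]] : exists x y, [/\ gadj x y, core v x & core w y].
    by apply: core_edge; rewrite /proper_edge vw.
  by exists x, y; rewrite (owner_core vx) (owner_core wy).
- by exists (base v); apply/owner_core/star_core/base_star.
(* The margin in [g_range] keeps blocks off the rim. The rim is thus a connected set of unclaimed
   points and has a single owner. *)
have un (p : gpoint) : ~~ ((0 < p.1 < n) && (0 < p.2 < n)) -> unclaimed p.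
  by move=> np; apply/forallP => v; apply: contra np; exact: core_inner.
have ur a b : a <= n -> b <= n -> [|| a == 0, a == n, b == 0 | b == n] ->
    unclaimed (pt n a b).
  move=> ha hb H; apply: un; rewrite pt1 ?pt2 //.
  by move: H ha hb; clear; lia.
exists (owner (pt n 0 0)) => x xN; apply: owner_component; first exact: ur.
have l1 := coord1_le x; have l2 := coord2_le x.
have ring :
    [|| x.1 == 0 :> nat, x.1 == n :> nat, x.2 == 0 :> nat | x.2 == n :> nat].
  apply: contraTT xN => nring.
  have /andP[/andP[a1 a2] /andP[b1 b2]] : (0 < x.1 < n) && (0 < x.2 < n).
    by move: nring l1 l2; clear; lia.
  by rewrite /faces_at /face a1 a2 b1 b2 l1 l2 !ltn0Sn.
rewrite -[x]ptE; case/or4P: ring => /eqP ->.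
- by apply: connect_col => // b hb; rewrite ur ?eqxx // (leq_trans hb).
- apply: (@connect_trans _ _ (pt n n 0)).
    by apply: connect_row => // a ha; rewrite ur ?eqxx ?orbT.
  by apply: connect_col => // b hb; rewrite ur ?eqxx ?orbT // (leq_trans hb).
- by apply: connect_row => // a ha; rewrite ur ?eqxx ?orbT // (leq_trans ha).
- apply: (@connect_trans _ _ (pt n 0 n)).
    by apply: connect_col => // b hb; rewrite ur ?eqxx ?orbT.
  by apply: connect_row => // a ha; rewrite ur ?eqxx ?orbT // (leq_trans ha).
Qed.

End Samples.

(** * The pursuit strategy *)

Section Geodesics.

Variables (T : finType) (e : rel T) (c : T) (tp : T -> T).
Hypothesis e_sym : symmetric e.
Hypothesis e_refl : reflexive e.
Hypothesis e_conn : forall x, connect e c x.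
Hypothesis tp_root : tp c = c.
Hypothesis tp_parent : forall x, x != c ->
  e (tp x) x /\ gdist e c x = (gdist e c (tp x)).+1.

Local Notation d := (gdist e c).

Lemma gdist_eq0 x : d x = 0 -> x = c.
Proof.
by move=> dx; apply/eqP; apply: contraT => /tp_parent[_]; rewrite dx.
Qed.

Lemma tp_dist x : d (tp x) = (d x).-1.
Proof.
case: (eqVneq x c) => [->|/tp_parent[_ ->] //].
by rewrite tp_root gdist_root.
Qed.

Lemma iter_tp_dist i x : d (iter i tp x) = d x - i.
Proof. by elim: i => [|i IH]; rewrite ?subn0 //= tp_dist IH subnS. Qed.

Lemma tp_edge x : e (tp x) x.
Proof.
by case: (eqVneq x c) => [->|/tp_parent[]//]; rewrite tp_root.
Qed.

(** The point at distance [a] from the root on the tree path of [u]; for [a] beyond [d u] it is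
    [u]. *)
Definition ancestor (u : T) (a : nat) : T := iter (d u - a) tp u.

Lemma ancestor0 u : ancestor u 0 = c.
Proof. by apply: gdist_eq0; rewrite iter_tp_dist subn0 subnn. Qed.

Lemma ancestorS u a : a < d u -> tp (ancestor u a.+1) = ancestor u a.
Proof. by move=> h; rewrite /ancestor -iterS -subSn // subSS. Qed.

Lemma ancestor_edge u a b : a <= d u -> b <= d u -> near1 a b ->
  e (ancestor u a) (ancestor u b).
Proof.
move=> ha hb; rewrite /near1 => /andP[ab ba].
case: (ltngtP a b) => [lt|gt|->]; last exact: e_refl.
  have -> : b = a.+1 by apply/eqP; rewrite eqn_leq ba.
  by rewrite -(ancestorS (leq_trans lt hb)) tp_edge.
have -> : a = b.+1 by apply/eqP; rewrite eqn_leq ab.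
by rewrite e_sym -(ancestorS (leq_trans gt ha)) tp_edge.
Qed.

Lemma ancestor_dist u v : fconnect tp u v -> d v <= d u /\ v = ancestor u (d v).
Proof.
move=> /iter_findex; set i := findex _ _ _ => E.
have dv : d v = d u - i by rewrite -E iter_tp_dist.
split; first by rewrite dv leq_subr.
case: (leqP i (d u)) => hi; first by rewrite /ancestor dv subKn // E.
have v0 : d v = 0 by rewrite dv; apply/eqP; rewrite subn_eq0 ltnW.
by rewrite v0 ancestor0; exact: gdist_eq0.
Qed.

(* x |-> ancestor u (shadow u x) is a retraction of the graph onto the tree path
   of u. *)
Definition shadow (u x : T) : nat := minn (d x) (d u).

Lemma shadow_near u x y : e x y -> near1 (shadow u x) (shadow u y).
Proof.
move=> xy; have := gdist_step e_conn xy.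
have := gdist_step e_conn (etrans (e_sym y x) xy).
by rewrite /near1 /shadow; clear; lia.
Qed.

(* A guard climbs the path until it meets the shadow, and then follows it. *)
Fixpoint height (sh : nat -> nat) (t : nat) : nat :=
  if t is s.+1 then minn (height sh s).+1 (sh s) else 0.

Lemma height_near sh t : (forall s, near1 (sh s) (sh s.+1)) ->
  near1 (height sh t) (height sh t.+1).
Proof.
move=> H; case: t => [|t] /=; first by rewrite /near1 /=; clear; lia.
by have := H t; rewrite /near1; clear; lia.
Qed.

(** A guard that has not met the shadow has climbed one step in every round; as the shadow never
    exceeds [L], they meet by round [L]. Afterwards the shadow moves by at most one and is followed.
    The index shift reflects that cops answer the robber's previous position. *)
Lemma height_caught sh L t : (forall s, near1 (sh s) (sh s.+1)) ->
  (forall s, sh s <= L) -> L <= t.+1 -> height sh t.+1 = sh t.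
Proof.
move=> near H Lt; have : height sh t.+1 = t.+1 \/ height sh t.+1 = sh t.
  elim: t {Lt} => [|t IH] /=; first by clear; lia.
  by have := near t; move: IH => /=; rewrite /near1; clear; lia.
case=> // E; apply/eqP; rewrite eqn_leq [X in X && _]/= geq_minr E.
exact: leq_trans Lt.
Qed.

Lemma height_le sh L t : (forall s, sh s <= L) -> height sh t <= L.
Proof. by case: t => [|t] //= H; rewrite geq_min H orbT. Qed.

Lemma height_ext sh sh' t : (forall s, s < t -> sh s = sh' s) ->
  height sh t = height sh' t.
Proof.
elim: t => //= t IH H; rewrite H // IH // => s st.
by apply: H; exact: ltnW.
Qed.

(** * Phases, guards and the shrinking territory *)

Section Strategy.

Variables (rho : nat) (sep : {set T} -> 'I_4 -> T).
Hypothesis rho_ge : forall x, d x <= rho.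

Definition territory (B : {set T}) (x : T) : {set T} :=
  [set w | (w \notin B) && connect (restr_rel e (fun z => z \notin B)) x w].

Fixpoint blocked (r : nat -> T) (j : nat) : {set T} :=
  if j is i.+1 then
    blocked r i :|: [set v | [exists b,
      fconnect tp (sep (territory (blocked r i) (r (i * rho))) b) v]]
  else set0.

Definition zone_at (r : nat -> T) (j : nat) : {set T} :=
  territory (blocked r j) (r (j * rho)).

Definition target (r : nat -> T) (j : nat) (b : 'I_4) : T :=
  sep (zone_at r j) b.

(* Phase j lasts from round j * rho + 1 to round (j + 1) * rho; before it the
   guards of phase j wait at the root. *)
Definition guard (r : nat -> T) (t j : nat) (b : 'I_4) : T :=
  ancestor (target r j b)
    (height (fun s => shadow (target r j b) (r (j * rho + s))) (t - j * rho)).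

Definition phase_strategy (k : nat) : cop_strategy T k :=
  fun h => [ffun i : 'I_k =>
    guard (nth c h) (size h) (i %/ 4) (inord (i %% 4))].

Lemma blocked_ext r r' j : (forall i, i < j -> r (i * rho) = r' (i * rho)) ->
  blocked r j = blocked r' j.
Proof.
elim: j => //= j IH H; rewrite IH => [|i ij]; last by apply: H; exact: ltnW.
by rewrite H.
Qed.

(** A guard reacts only to the past, so [phase_strategy] may pad the history with [c]. Until round
    [j * rho] the target is still unknown, but height 0 is the root whatever the target. *)
Lemma guard_ext r r' t j b : (forall s, s < t -> r s = r' s) ->
  guard r t j b = guard r' t j b.
Proof.
move=> H; rewrite /guard; case: (leqP t (j * rho)) => tj.
  by move: tj; rewrite -subn_eq0 => /eqP->; rewrite /= !ancestor0.
have -> : target r j b = target r' j b.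
  rewrite /target /zone_at H // (@blocked_ext r r') // => i ij; apply: H.
  by apply: leq_ltn_trans tj; rewrite leq_mul2r (ltnW ij) orbT.
congr ancestor; apply: height_ext => s st; rewrite H //.
by move: st; rewrite ltn_subRL.
Qed.

Lemma phase_strategyE k r t (i : 'I_k) :
  cops_at (phase_strategy k) r t i = guard r t (i %/ 4) (inord (i %% 4)).
Proof.
rewrite /cops_at ffunE size_mkseq; apply: guard_ext => s st.
by rewrite nth_mkseq.
Qed.

Lemma shadow_le u x : shadow u x <= d u.
Proof. exact: geq_minr. Qed.

Lemma phase_strategy_legal k : legal_strategy e (phase_strategy k).
Proof.
move=> r play t i; rewrite !phase_strategyE /guard.
set u := target _ _ _; set sh := fun s => _.
have shu s : sh s <= d u by exact: shadow_le.
case: (ltnP t (i %/ 4 * rho)) => tj.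
  have -> : t.+1 - i %/ 4 * rho = 0 by apply/eqP; rewrite subn_eq0.
  have -> : t - i %/ 4 * rho = 0 by apply/eqP; rewrite subn_eq0 ltnW.
  exact: e_refl.
rewrite subSn //; apply: ancestor_edge; try exact: height_le.
by apply: height_near => s; apply: shadow_near; rewrite addnS; exact: play.
Qed.

Lemma guard_caught r t j b : robber_play e r -> j.+1 * rho <= t.+1 -> 0 < rho ->
  guard r t.+1 j b = ancestor (target r j b) (shadow (target r j b) (r t)).
Proof.
move=> play ht rho0; rewrite /guard; congr ancestor.
have jt : j * rho <= t.
  by rewrite -ltnS; apply: leq_trans ht; rewrite mulSn -addn1 addnC leq_add2r.
rewrite subSn // (@height_caught _ (d (target r j b))) ?subnKC //.
- by move=> s; apply: shadow_near; rewrite addnS; exact: play.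
- by move=> s; exact: shadow_le.
apply: leq_trans (rho_ge _) _; rewrite -subSn // leq_subRL; last exact: leqW.
by rewrite addnC -mulSn.
Qed.

Lemma robber_connect (r : nat -> T) (B : {set T}) a n :
  robber_play e r -> (forall s, a <= s <= a + n -> r s \notin B) ->
  connect (restr_rel e (fun z => z \notin B)) (r a) (r (a + n)).
Proof.
move=> play; elim: n => [|n IH] H; first by rewrite addn0 connect0.
apply: connect_trans (IH _) (connect1 _) => [s /andP[h1 h2]|].
  by apply: H; rewrite h1 addnS leqW.
rewrite addnS /restr_rel play !H ?leq_addr ?addnS ?leqnn ?leqnSn //.
by rewrite leqW ?leq_addr.
Qed.

Hypothesis sepP : forall (W : {set T}),
  let A : pred T := fun v => [forall b, ~~ fconnect tp (sep W b) v] in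
  forall v, A v ->
    2 * #|[pred w | (w \in W) && connect (restr_rel e A) v w]| <= #|W|.

Lemma phase_capture k r L : 4 * L <= k -> #|T| < 2 ^ L -> 0 < rho ->
  robber_play e r ->
  exists2 t, t <= L * rho & captured_in (phase_strategy k) r t.
Proof.
move=> Lk TL rho0 play.
case: (boolP [exists t : 'I_(L * rho).+1, captured_in (phase_strategy k) r t]).
  by case/existsP=> t ct; exists t => //; rewrite -ltnS.
move=> /existsPn nocap.
(* A robber standing on a guarded path is its own shadow, so cop [4 * i + b] would move onto it in
   round s + 1. *)
have free i b s : i < L -> i.+1 * rho <= s.+1 -> s.+1 <= L * rho ->
    ~~ fconnect tp (target r i b) (r s).
  move=> iL is_ sL; apply/negP => con.
  have ik : 4 * i + b < k.
    apply: leq_trans Lk.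
    apply: (@leq_trans (4 * i.+1)); last by rewrite leq_mul2l.
    by rewrite mulnS addnC ltn_add2r.
  have := nocap (Ordinal (sL : s.+1 < (L * rho).+1)).
  rewrite /captured_in /= => /norP[_ /existsPn /(_ (Ordinal ik))].
  rewrite phase_strategyE /= mulnC divnMDl // divn_small ?addn0 //.
  rewrite modnMDl modn_small // inord_val guard_caught // => /eqP; apply.
  have [dv E] := ancestor_dist con.
  by rewrite /shadow (minn_idPl dv) -E.
have unblocked i s : i <= L -> i * rho <= s.+1 -> s.+1 <= L * rho ->
    r s \notin blocked r i.
  elim: i => [|i IH] iL is_ sL /=; first by rewrite inE.
  rewrite !inE negb_or IH ?(ltnW iL) //=; last first.
    by apply: leq_trans is_; rewrite leq_mul2r leqnSn orbT.
  by apply/existsPn => b; exact: free.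
have step i s : i < L -> i.+1 * rho <= s.+1 -> s.+1 <= L * rho ->
    let A : pred T := fun v => [forall b, ~~ fconnect tp (target r i b) v] in
    [/\ A (r s), connect (restr_rel e (fun z => z \notin blocked r i))
                   (r (i * rho)) (r s) &
    2 * #|[pred w | (w \in zone_at r i) && connect (restr_rel e A) (r s) w]|
      <= #|zone_at r i|].
  move=> iL is_ sL A.
  have As : A (r s) by apply/forallP => b; exact: free.
  split; [by []| |exact: (@sepP (zone_at r i) (r s) As)].
  have his : i * rho <= s.
    rewrite -ltnS; apply: leq_trans is_.
    by rewrite mulSn -addn1 addnC leq_add2r.
  rewrite -(subnKC his); apply: robber_connect => // u.
  rewrite subnKC // => /andP[h1 h2]; apply: unblocked; first exact: ltnW.
    exact: leqW.
  exact: leq_trans sL.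
(* The territory at the start of phase i + 1 lies in one component left by the four paths of phase
   i, which holds at most half of the previous territory. *)
have half i : i < L -> 2 ^ i * #|zone_at r i| <= #|T|.
  elim: i => [|i IH] iL; first by rewrite mul1n max_card.
  have h1 : i.+1 * rho <= (i.+1 * rho).+1 by [].
  have h2 : (i.+1 * rho).+1 <= L * rho.
    apply: (@leq_trans (i.+2 * rho)); last by rewrite leq_mul2r iL orbT.
    by rewrite [i.+2 * _]mulSn -add1n leq_add2r.
  have [As con le] := step i _ (ltnW iL) h1 h2.
  apply: leq_trans (IH (ltnW iL)); rewrite expnS -mulnA mulnCA leq_mul2l.
  apply/orP; right; apply: leq_trans le; rewrite leq_mul2l /=.
  apply/subset_leq_card/subsetP => w; rewrite !inE => /andP[].
  rewrite negb_or => /andP[wB _] xw.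
  rewrite wB; apply/andP; split.
    apply: connect_trans con _; apply: restr_connectS xw => z.
    by rewrite !inE negb_or => /andP[].
  apply: restr_connectS xw => z; rewrite !inE negb_or => /andP[_ /existsPn H].
  exact/forallP.
case: L TL Lk nocap free unblocked step half =>
  [|L] TL Lk _ _ unblocked step half.
  rewrite expn0 ltnS leqn0 in TL.
  by have := max_card (pred1 c); rewrite (eqP TL) card1.
have h0 : 0 < L.+1 * rho by rewrite muln_gt0.
have h1 : L.+1 * rho <= (L.+1 * rho).-1.+1 by rewrite prednK.
have h2 : (L.+1 * rho).-1.+1 <= L.+1 * rho by rewrite prednK.
(* In the last round the territory is halved once more and still contains the robber, which gives 2
   ^ (L + 1) <= #|T|. *)
have [As con le] := step L _ (ltnSn L) h1 h2.
have : 2 ^ L * 2 <= #|T|.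
  apply: leq_trans (half L (ltnSn L)); rewrite leq_mul2l; apply/orP; right.
  apply: leq_trans le; rewrite -[X in X <= _]muln1 leq_mul2l /=.
  apply/card_gt0P; exists (r (L.+1 * rho).-1); rewrite !inE connect0 con !andbT.
  apply: unblocked => //; apply: leq_trans h1.
  by rewrite leq_mul2r leqnSn orbT.
by rewrite -expnSr leqNgt TL.
Qed.

End Strategy.

End Geodesics.

(** * Rounding a plane drawing *)

From mathcomp Require Import all_order all_algebra.
From mathcomp Require Import all_classical all_reals all_analysis.
From mathcomp Require Import lra.
Import Order.TTheory GRing.Theory Num.Theory.
Import numFieldNormedType.Exports.

Local Open Scope nat_scope.
Section Arcs.

Local Open Scope ring_scope.
Local Open Scope classical_set_scope.

Variable R : realType.
Implicit Types f g : R -> R * R.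

Lemma arcs_apart f g (a b c d : R) : continuous f -> continuous g ->
  (forall s t, a <= s <= b -> c <= t <= d -> f s <> g t) ->
  exists2 del : R, 0 < del &
    forall s t, a <= s <= b -> c <= t <= d -> del <= `|f s - g t|.
Proof.
move=> cf cg fg.
have [[[s0 t0] /= [hs ht]]|no] := pselect ((`[a, b] `*` `[c, d]) !=set0);
  last first.
  exists 1 => // s t hs ht; exfalso; apply: no; exists (s, t).
  by split; rewrite /= in_itv.
pose F (p : R * R) : R := `|f p.1 - g p.2|.
have cF : continuous F.
  move=> p; apply: (@continuous_comp _ _ _ (fun p => f p.1 - g p.2) Num.norm).
    apply: cvgB.
      by apply: (@continuous_comp _ _ _ fst f); [exact: cvg_fst|exact: cf].
    by apply: (@continuous_comp _ _ _ snd g); [exact: cvg_snd|exact: cg].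
  exact: norm_continuous.
have [|[s1 t1]] := @compact_EVT_min _ R F (`[a, b] `*` `[c, d]) _
  (compact_setX (@segment_compact _ a b) (@segment_compact _ c d))
  (continuous_subspaceT cF).
  by exists (s0, t0).
rewrite inE /= !in_itv /= => -[hs1 ht1] Hmin.
exists (F (s1, t1)) => [|s t hs' ht'].
  by rewrite normr_gt0 subr_eq0; apply/eqP/fg.
by apply: (Hmin (s, t)); rewrite inE /= !in_itv.
Qed.

(** Uniform continuity: [del] is the minimum of |s - t| over the compact set of pairs with |f s - f
    t| >= eps, positive since that set misses the diagonal. *)
Lemma arc_modulus f (eps : R) : continuous f -> 0 < eps ->
  exists2 del : R, 0 < del &
    forall s t, 0 <= s <= 1 -> 0 <= t <= 1 -> `|s - t| < del ->
      `|f s - f t| < eps.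
Proof.
move=> cf eps0.
pose F (p : R * R) : R := `|f p.1 - f p.2|.
have cF : continuous F.
  move=> p; apply: (@continuous_comp _ _ _ (fun p => f p.1 - f p.2) Num.norm).
    apply: cvgB.
      by apply: (@continuous_comp _ _ _ fst f); [exact: cvg_fst|exact: cf].
    by apply: (@continuous_comp _ _ _ snd f); [exact: cvg_snd|exact: cf].
  exact: norm_continuous.
pose D (p : R * R) : R := `|p.1 - p.2|.
have cD : continuous D.
  move=> p; apply: (@cvg_norm _ R^o).
  by apply: cvgB; [exact: cvg_fst|exact: cvg_snd].
pose I2 : set (R * R) := `[0, 1] `*` `[0, 1].
pose C : set (R * R) := (F @^-1` [set x | eps <= x]) `&` I2.
have cptI : compact I2.
  by apply: compact_setX; exact: segment_compact.
have cptC : compact C.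
  rewrite /C setIC; apply: compact_closedI; first exact: cptI.
  apply: preimage_closed; last exact: closed_ge.
  by move=> p _; apply: cF.
have [C0|no] := pselect (C !=set0); last first.
  exists 1 => // s t hs ht _; rewrite ltNge; apply/negP => h.
  by apply: no; exists (s, t); split=> //; split; rewrite /= in_itv.
have [[s1 t1]] := compact_EVT_min C0 cptC (continuous_subspaceT cD).
rewrite inE => -[h1 _] Hmin; exists (D (s1, t1)) => [|s t hs ht].
  rewrite normr_gt0 subr_eq0; apply/eqP => /= E.
  by move: h1; rewrite /F /= E subrr normr0 leNgt eps0.
apply: contraTT; rewrite -!leNgt => h.
by apply: (Hmin (s, t)); rewrite inE; split=> //; split; rewrite /= in_itv.
Qed.

(** Composing with this retraction onto [0, 1] turns continuity within the interval into continuity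
    on the whole line. *)
Definition clamp (t : R) : R := Num.max 0 (Num.min 1 t).

Lemma clamp01 t : 0 <= clamp t <= 1.
Proof. by rewrite /clamp le_max lexx ge_max ler01 ge_min lexx. Qed.

Lemma clamp_id t : 0 <= t <= 1 -> clamp t = t.
Proof. by case/andP=> h0 h1; rewrite /clamp (min_idPr h1) (max_idPr h0). Qed.

Lemma clamp_continuous : continuous clamp.
Proof.
move=> t; apply: continuous_max; first exact: cvg_cst.
by apply: continuous_min; [exact: cvg_cst|exact: cvg_id].
Qed.

Lemma comp_clamp_continuous f : {within `[0, 1], continuous f} ->
  continuous (f \o clamp).
Proof.
move=> /subspace_continuousP cf t.
have ct : `[0, 1]%classic (clamp t) by rewrite /= in_itv; exact: clamp01.
apply: cvg_comp (cf _ ct) => A /=; rewrite /within /= => nA.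
have : nbhs t (clamp @^-1` [set x | `[0, 1]%classic x -> A x]).
  exact: clamp_continuous nA.
apply: filterS => x /= Ax; apply: Ax.
by rewrite /= in_itv; exact: clamp01.
Qed.

End Arcs.
Section Rounding.

Local Open Scope ring_scope.

Variable R : realType.

(* Rounding to the grid of mesh 1/M; B makes the coordinates nonnegative. *)
Definition round (M B : nat) (z : R * R) : nat * nat :=
  (absz (Num.floor (M%:R * z.1) + B%:Z), absz (Num.floor (M%:R * z.2) + B%:Z)).

Definition round_bound (M B : nat) (z : R * R) : bool :=
  (`|Num.floor (M%:R * z.1)| <= B)%N && (`|Num.floor (M%:R * z.2)| <= B)%N.

Lemma floor_dist (a b : R) (K : nat) :
  (absz (Num.floor a - Num.floor b) <= K)%N -> `|a - b| < K.+1%:R.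
Proof.
move=> h.
have /andP[a1 a2] := floor_itv a; have /andP[b1 b2] := floor_itv b.
have : `|(Num.floor a - Num.floor b)%:~R| <= K%:R :> R.
  by rewrite -intr_norm -abszE -pmulrn ler_nat.
rewrite rmorphB /= ler_norml => /andP[h1 h2].
rewrite rmorphD /= in a2 b2; rewrite -natr1 ltr_norml; apply/andP; split; lra.
Qed.

Lemma dist_floor (a b : R) : `|a - b| < 1 ->
  (absz (Num.floor a - Num.floor b) <= 1)%N.
Proof.
move=> h.
have /andP[a1 a2] := floor_itv a; have /andP[b1 b2] := floor_itv b.
rewrite rmorphD /= in a2 b2; move: h; rewrite ltr_norml => /andP[h1 h2].
have : (Num.floor a - Num.floor b)%:~R < 2%:~R :> R by rewrite rmorphB /=; lra.
have : (-2)%:~R < (Num.floor a - Num.floor b)%:~R :> R.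
  by rewrite rmorphB /= rmorphN /=; lra.
rewrite !ltr_int; lia.
Qed.

Lemma round_near M B z z' : (0 < M)%N ->
  round_bound M B z -> round_bound M B z' -> `|z - z'| < M%:R^-1 ->
  near1 (round M B z).1 (round M B z').1 &&
  near1 (round M B z).2 (round M B z').2.
Proof.
move=> M0 /andP[b1 b2] /andP[b1' b2'].
have M0' : 0 < M%:R :> R by rewrite ltr0n.
rewrite prod_normE gt_max /= => /andP[h1 h2].
have scale (a b : R) : `|a - b| < M%:R^-1 -> `|M%:R * a - M%:R * b| < 1.
  move=> h; rewrite -mulrBr normrM (gtr0_norm M0') mulrC.
  by rewrite -ltr_pdivlMr // mul1r.
have := dist_floor (scale _ _ h1); have := dist_floor (scale _ _ h2).
rewrite /round /near1 /=; move: b1 b2 b1' b2'; clear; lia.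
Qed.

(** Blocks that meet have centres within 2 in each coordinate, and floors within 2 come from reals
    less than 3 apart. *)
Lemma round_apart M B z z' :
  round_bound M B z -> round_bound M B z' -> 3 <= M%:R * `|z - z'| ->
  ~~ boxes_meet (round M B z) (round M B z').
Proof.
move=> /andP[b1 b2] /andP[b1' b2']; apply: contraTN => h; rewrite -ltNge.
rewrite -[X in X * _](ger0_norm (ler0n _ M)) -normrZ prod_normE gt_max /=.
have scale (a b : R) : M%:R *: (a - b) = M%:R * a - M%:R * b.
  by rewrite /GRing.scale /= mulrBr.
rewrite !scale.
apply/andP; split; apply: floor_dist; move: h;
  rewrite /boxes_meet /near2 /round /=;
  move: b1 b2 b1' b2'; clear; lia.
Qed.

Lemma round_range M B z : round_bound M B z ->
  (1 < (round M B.+2 z).1 < (B.*2 + 6).-1)%N &&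
  (1 < (round M B.+2 z).2 < (B.*2 + 6).-1)%N.
Proof. by rewrite /round_bound /round /=; clear; lia. Qed.

Lemma fin_eventually (I : finType) (P : I -> nat -> Prop) :
  (forall i, exists M0, forall M, (M0 <= M)%N -> P i M) ->
  exists M0, forall M i, (M0 <= M)%N -> P i M.
Proof.
move=> /fin_all_exists[f fP]; exists (\max_i f i)%N => M i hM.
by apply: fP; apply: leq_trans hM; exact: leq_bigmax.
Qed.

Lemma scale_eventually (del : R) : 0 < del ->
  exists M0 : nat, forall M : nat, (M0 <= M)%N -> 3 <= M%:R * del.
Proof.
move=> d0; exists (Num.truncn (3 / del)).+1 => M hM.
rewrite -ler_pdivrMr //; apply: ltW; apply: lt_le_trans (truncnS_gt _) _.
by rewrite ler_nat.
Qed.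

End Rounding.

(** * Sampling the curves of a drawing *)

Section Drawing.

Local Open Scope ring_scope.

Variables (R : realType) (V : finType) (e : rel V).
Variables (pos : V -> R * R) (arc : V -> V -> R -> R * R).
Hypothesis e_sym : symmetric e.
Hypothesis drawing : plane_drawing e pos arc.

Definition curve (v w : V) : R -> R * R :=
  if proper_edge e v w then arc v w \o @clamp R else fun=> pos v.

Lemma curve_arc v w t : proper_edge e v w -> 0 <= t <= 1 ->
  curve v w t = arc v w t.
Proof. by move=> vw ht; rewrite /curve vw /= clamp_id. Qed.

Lemma curve0 v w : curve v w 0 = pos v.
Proof.
case: (boolP (proper_edge e v w)) => vw; last by rewrite /curve (negbTE vw).
rewrite curve_arc ?lexx ?ler01 //; case/andP: vw.
exact: drawing_arc_start drawing v w.
Qed.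

Lemma curve_continuous v w : continuous (curve v w).
Proof.
rewrite /curve; case: ifP => [/andP[vw nvw]|_]; last exact: cst_continuous.
apply: comp_clamp_continuous.
exact: drawing_arc_continuous drawing v w vw nvw.
Qed.

Lemma curve_rev v w t : proper_edge e v w -> 0 <= t <= 1 ->
  curve w v t = curve v w (1 - t).
Proof.
move=> vw ht; have wv : proper_edge e w v by rewrite /proper_edge e_sym eq_sym.
rewrite !curve_arc //; last lra.
by case/andP: vw => vw nvw; rewrite (drawing_arc_rev drawing vw nvw) // in_itv.
Qed.

Lemma curve_start v w t : 0 <= t <= 3^-1 -> curve v w t = pos v \/
  [/\ proper_edge e v w, 0 < t & curve v w t = arc v w t].
Proof.
move=> /andP[t0 t1]; case: (boolP (proper_edge e v w)) => vw; last first.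
  by left; rewrite /curve (negbTE vw).
case: (eqVneq t 0) => [->|tn0]; first by left; exact: curve0.
right; split=> //; first by rewrite lt_neqAle eq_sym tn0.
by rewrite curve_arc //; lra.
Qed.

Lemma arcs_disjoint v w x y s t : proper_edge e v w -> proper_edge e x y ->
  ~~ ((v == x) && (w == y) || (v == y) && (w == x)) ->
  0 < s < 1 -> 0 < t < 1 -> arc v w s <> arc x y t.
Proof.
move=> /andP[vw nvw] /andP[xy nxy] ne hs ht.
have D := drawing_arc_disjoint drawing vw nvw xy nxy.
apply: D; rewrite ?in_itv //=.
apply: contra ne => /eqP E.
have /set2P v_in : v \in [set x; y]%SET by rewrite -E set21.
have /set2P w_in : w \in [set x; y]%SET by rewrite -E set22.
case: v_in w_in nvw => -> [] ->; rewrite ?eqxx ?orbT //.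
Qed.

Lemma arc_vertex v w z t : proper_edge e v w -> 0 < t < 1 -> arc v w t <> pos z.
Proof.
move=> /andP[vw nvw] ht.
by apply: (drawing_arc_vertex drawing vw nvw); rewrite in_itv.
Qed.

Lemma star_apart v w x y s t : v != x ->
  0 <= s <= 3^-1 -> 0 <= t <= 3^-1 -> curve v w s <> curve x y t.
Proof.
move=> vx hs ht.
have /andP[_ s3] := hs; have /andP[_ t3] := ht.
have [->|[vw s0 ->]] := curve_start v w hs;
  have [->|[xy t0 ->]] := curve_start x y ht.
- by move=> /(drawing_pos_inj drawing) E; rewrite E eqxx in vx.
- by move=> E; apply: (@arc_vertex x y v t) => //; lra.
- by apply: arc_vertex => //; lra.
(* Both curves may be the same arc run from opposite ends; injectivity then forces s = 1 - t,
   impossible for first thirds. *)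
case: (boolP ((v == x) && (w == y) || (v == y) && (w == x))) => [|ne].
  rewrite (negbTE vx) /= => /andP[/eqP Ev /eqP Ew]; subst y x.
  have /andP[vw1 vw2] := vw.
  rewrite (drawing_arc_rev drawing vw1 vw2) ?in_itv /=; last lra.
  move=> /(drawing_arc_inj drawing vw1 vw2); rewrite !in_itv /= => E.
  have : s = 1 - t by apply: E; lra.
  lra.
by apply: arcs_disjoint => //; lra.
Qed.

Lemma middles_apart v w x y s t : proper_edge e v w -> proper_edge e x y ->
  ~~ ((v == x) && (w == y) || (v == y) && (w == x)) ->
  3^-1 <= s <= 2 / 3 -> 3^-1 <= t <= 2 / 3 -> curve v w s <> curve x y t.
Proof.
move=> vw xy ne hs ht.
have hs' : 0 <= s <= 1 by lra.
have ht' : 0 <= t <= 1 by lra.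
rewrite (curve_arc vw hs') (curve_arc xy ht').
by apply: arcs_disjoint => //; lra.
Qed.

Lemma middle_star_apart v w z y s t : proper_edge e v w -> z != v -> z != w ->
  3^-1 <= s <= 2 / 3 -> 0 <= t <= 3^-1 -> curve v w s <> curve z y t.
Proof.
move=> vw zv zw hs ht; rewrite curve_arc //; last lra.
have /andP[_ t3] := ht.
have [->|[zy t0 ->]] := curve_start z y ht.
  by apply: arc_vertex => //; lra.
apply: arcs_disjoint => //; [|lra|lra].
by rewrite ![_ == z]eq_sym (negbTE zv) (negbTE zw) /= andbF.
Qed.

Lemma curves_apart v w x y (a b c d : R) (P : Prop) :
  (P -> forall s t, a <= s <= b -> c <= t <= d -> curve v w s <> curve x y t) ->
  exists M0 : nat, forall M : nat, (M0 <= M)%N -> P ->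
    forall s t, a <= s <= b -> c <= t <= d ->
      3 <= M%:R * `|curve v w s - curve x y t|.
Proof.
move=> H; have [/H h|nP] := pselect P; last by exists 0 => M _ /nP.
have [del del0 hd] :=
  arcs_apart (@curve_continuous v w) (@curve_continuous x y) h.
have [M0 HM] := scale_eventually del0; exists M0 => M hM _ s t hs ht.
by apply: le_trans (HM _ hM) _; apply: ler_wpM2l (hd _ _ hs ht).
Qed.

Lemma curve_samples (eps : R) : 0 < eps -> exists2 m : nat, (0 < m)%N &
  forall v w k, (k < 3 * m)%N ->
    `|curve v w (k%:R / (3 * m)%:R) - curve v w (k.+1%:R / (3 * m)%:R)| < eps.
Proof.
move=> eps0.
have [m0 Hm0] : exists m0, forall (m : nat) (q : V * V), (m0 <= m)%N ->
    (0 < m)%N -> forall k, (k < 3 * m)%N ->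
    `|curve q.1 q.2 (k%:R / (3 * m)%:R)
      - curve q.1 q.2 (k.+1%:R / (3 * m)%:R)| < eps.
  apply: fin_eventually => -[v w] /=.
  have [del del0 Hdel] := arc_modulus (@curve_continuous v w) eps0.
  have [m0 Hm0] := scale_eventually del0; exists m0 => m /Hm0 hm mp k hk.
  have m3 : 0 < (3 * m)%:R :> R by rewrite ltr0n muln_gt0.
  have in01 l : (l <= 3 * m)%N -> 0 <= (l%:R / (3 * m)%:R : R) <= 1.
    by move=> hl; rewrite divr_ge0 ?ler0n //= ler_pdivrMr // mul1r ler_nat.
  apply: Hdel; [exact/in01/ltnW|exact: in01|].
  rewrite -mulrBl -natr1 opprD addrA subrr sub0r mulN1r normrN.
  rewrite gtr0_norm ?invr_gt0 // -div1r ltr_pdivrMr // natrM mulrC.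
  by move: hm; lra.
by exists m0.+1 => // v w k hk; apply: (Hm0 _ (v, w)).
Qed.

Lemma drawing_model : (0 < #|V|)%N -> exists n phi, @grid_model V e n phi.
Proof.
move=> /card_gt0P[v0 _].
have [M1 HM1] := fin_eventually (fun q : V * V * (V * V) =>
  curves_apart (fun h s t => @star_apart q.1.1 q.1.2 q.2.1 q.2.2 s t h)).
pose mid_hyp (v w x y : V) := [/\ proper_edge e v w, proper_edge e x y &
  ~~ ((v == x) && (w == y) || (v == y) && (w == x))].
have mid_apart v w x y : mid_hyp v w x y -> forall s t,
    3^-1 <= s <= 2 / 3 -> 3^-1 <= t <= 2 / 3 -> curve v w s <> curve x y t.
  by case=> vw xy ne s t; exact: middles_apart.
have [M2 HM2] := fin_eventually (fun q : V * V * (V * V) =>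
  curves_apart (@mid_apart q.1.1 q.1.2 q.2.1 q.2.2)).
pose ms_hyp (v w z y : V) := [/\ proper_edge e v w, z != v & z != w].
have ms_apart v w z y : ms_hyp v w z y -> forall s t,
    3^-1 <= s <= 2 / 3 -> 0 <= t <= 3^-1 -> curve v w s <> curve z y t.
  by case=> vw zv zw s t; exact: middle_star_apart.
have [M3 HM3] := fin_eventually (fun q : V * V * (V * V) =>
  curves_apart (@ms_apart q.1.1 q.1.2 q.2.1 q.2.2)).
(* The mesh 1/M comes first, fine enough to keep disjoint pieces 3/M apart; then [m] makes
   consecutive samples closer than 1/M; finally [B] bounds the finitely many rounded samples. *)
pose M := (maxn M1 (maxn M2 M3)).+1.
have M1M : (M1 <= M)%N by apply: leqW; rewrite leq_max leqnn.
have M2M : (M2 <= M)%N by apply: leqW; rewrite !leq_max leqnn orbT.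
have M3M : (M3 <= M)%N by apply: leqW; rewrite !leq_max leqnn !orbT.
have Mi0 : 0 < M%:R^-1 :> R by rewrite invr_gt0 ltr0n.
have [m m0 Hm] := curve_samples Mi0.
pose tt (k : nat) : R := k%:R / (3 * m)%:R.
pose G v w k := curve v w (tt k).
pose size_at (z : R * R) :=
  (`|Num.floor (M%:R * z.1)| + `|Num.floor (M%:R * z.2)|)%N.
pose B := (\max_(q : V * V * 'I_(3 * m).+1) size_at (G q.1.1 q.1.2 q.2))%N.
have HB v w k : (k <= 3 * m)%N -> round_bound M B (G v w k).
  move=> hk; have : (size_at (G v w k) <= B)%N.
    exact: (leq_bigmax (v, w, Ordinal (hk : (k < (3 * m).+1)%N))).
  by rewrite /size_at /round_bound; clear; lia.
have HB2 v w k : (k <= 3 * m)%N -> round_bound M B.+2 (G v w k).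
  by move=> /(HB v w); rewrite /round_bound; clear; lia.
have m3 : 0 < (3 * m)%:R :> R by rewrite ltr0n muln_gt0.
have tt01 k : (k <= 3 * m)%N -> 0 <= tt k <= 1.
  by move=> hk; rewrite divr_ge0 ?ler0n //= ler_pdivrMr // mul1r ler_nat.
have mR : 0 < m%:R :> R by rewrite ltr0n.
have ttE k : tt k = k%:R / (3 * m%:R) by rewrite /tt natrM.
have tt_le k l : (k <= l * m)%N -> tt k <= l%:R / 3.
  rewrite ttE ler_pdivrMr ?mulr_gt0 // mulrA mulfVK // -natrM ler_nat //.
have tt_ge k l : (l * m <= k)%N -> l%:R / 3 <= tt k.
  by rewrite ttE ler_pdivlMr ?mulr_gt0 // mulrA mulfVK // -natrM ler_nat.
have star_rng k : (k <= m)%N -> 0 <= tt k <= 3^-1.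
  move=> hk; rewrite divr_ge0 ?ler0n //= -div1r.
  by apply: (tt_le k 1%N); rewrite mul1n.
have mid_rng k : (m <= k <= 2 * m)%N -> 3^-1 <= tt k <= 2 / 3.
  move=> /andP[h1 h2]; rewrite (tt_le k 2%N h2) andbT -div1r.
  by apply: (tt_ge k 1%N); rewrite mul1n.
have le3 k : (k <= m)%N -> (k <= 3 * m)%N by clear; lia.
have le23 k : (m <= k <= 2 * m)%N -> (k <= 3 * m)%N by clear; lia.
exists (B.*2 + 6)%N, (owner e m (fun v w k => round M B.+2 (G v w k)) v0).
apply: samples_model => //.
- by move=> v w k hk; apply: round_range; exact: HB.
- move=> v w k hk; apply: round_near; rewrite ?HB2 ?(ltnW hk) //.
  exact: Hm.
- by move=> v w; rewrite /G /tt mul0r !curve0.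
- move=> v w k vw hk; rewrite /G curve_rev ?tt01 //.
  congr (round _ _ (curve _ _ _)).
  by rewrite /tt natrB // mulrBl divff ?gt_eqF.
- move=> v w x y k l vx hk hl; apply: round_apart; rewrite ?HB2 ?le3 //.
  by apply: (HM1 M (v, w, (x, y))) => //; exact: star_rng.
- move=> v w x y k l vw xy ne hk hl; apply: round_apart; rewrite ?HB2 ?le23 //.
  by apply: (HM2 M (v, w, (x, y))) => //; exact: mid_rng.
- move=> v w z y k l vw zv zw hk hl.
  apply: round_apart; [exact/HB2/le23|exact/HB2/le3|].
  by apply: (HM3 M (v, w, (z, y))) => //; [exact: mid_rng|exact: star_rng].
Qed.

End Drawing.

(** * The capture time *)

Section Numeric.

Local Open Scope ring_scope.

Variable R : realType.

Lemma sq_le_expn L : (L.+1 ^ 2 <= 9 * 2 ^ L)%N.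
Proof.
elim: L => [//|L IH]; case: L IH => [//|[//|L]] IH.
by move: IH; rewrite [(2 ^ L.+3)%N]expnS; nia.
Qed.

Lemma log_le_sqrt (L n : nat) : (2 ^ L <= n)%N ->
  L.+1%:R <= 3 * Num.sqrt (n%:R : R).
Proof.
move=> Ln; rewrite -(ger0_norm (ler0n R L.+1)) -sqrtr_sqr.
have -> : 3 = Num.sqrt (9%:R : R).
  by rewrite (_ : 9%:R = 3 ^+ 2) ?sqrtr_sqr ?ger0_norm //; lra.
rewrite -sqrtrM // ler_wsqrtr // -natrX -natrM ler_nat.
by apply: leq_trans (sq_le_expn L) _; rewrite leq_mul2l.
Qed.

(** The bound ln (1/2) <= -1/2 gives ln 2 >= 1/2; positivity of [L] absorbs the extra phase. *)
Lemma log_le_ln (L n : nat) : (0 < L)%N -> (2 ^ L <= n)%N ->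
  L.+1%:R <= 6 * ln (n%:R : R).
Proof.
move=> L0 Ln.
have ln2 : 2^-1 <= ln 2 :> R.
  have := @le_ln1Dx R (- 2^-1).
  rewrite (_ : 1 + - 2^-1 = 2^-1 :> R); last lra.
  rewrite lnV ?posrE // lerN2; apply; lra.
have : L%:R * 2^-1 <= ln (n%:R : R).
  apply: (@le_trans _ _ (ln (2 ^+ L : R))).
    by rewrite lnXn // -[X in _ <= X]mulr_natl ler_wpM2l.
  rewrite ler_ln ?posrE ?exprn_gt0 ?ltr0n ?(leq_trans _ Ln) ?expn_gt0 //.
  by rewrite -natrX ler_nat.
have : 1 <= L%:R :> R by rewrite ler1n.
by rewrite -(natr1 L); lra.
Qed.

End Numeric.

Lemma graph_radius_center (T : finType) (e : rel T) : 0 < #|T| ->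
  exists c, eccentricity e c <= graph_radius e.
Proof.
move=> /card_gt0P[x0 _].
have [c _ cmin] := @arg_minnP _ x0 xpredT (eccentricity e) isT.
exists c; rewrite /graph_radius.
apply: (big_ind (fun m => eccentricity e c <= m)) => [|m m' h h'|x _].
- apply/bigmax_leqP => y _; rewrite -[leqRHS](size_iota 0).
  exact: find_size.
- by rewrite leq_min h.
- exact: cmin.
Qed.

Lemma capt_le (R : realType) (T : finType) (e : rel T) (k : nat)
    (s : cop_strategy T k) (b : nat) : legal_strategy e s ->
  (forall r, robber_play e r -> exists2 t, t <= b & captured_in s r t) ->
  (capt R e k <= (b%:R : R)%:E)%E.
Proof.
move=> legal H; apply: (@le_trans _ _ (strategy_length R e s)).
  by apply: ereal_inf_lbound; exists s.
apply: ge_ereal_sup => _ [r play <-]; have [t tb ct] := H r play.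
apply: (@le_trans _ _ (t%:R)%:E); last by rewrite lee_fin ler_nat.
by apply: ereal_inf_lbound; exists t.
Qed.

Local Open Scope ring_scope.

Theorem theorem4p1 (R : realType) (T : finType) (e : rel T) (k : nat)
    (e_sym : symmetric e) (e_refl : reflexive e)
    (e_conn : connected_graph e) (e_planar : planar R e)
    (hk : 12 * Num.sqrt (#|T|%:R : R) <= k%:R) :
  (capt R e k <= (6 * (graph_radius e)%:R * ln (#|T|%:R : R))%:E)%E.
Proof.
have [T0 conn] := e_conn.
have [c cR] := graph_radius_center e T0.
have [pos [arc drawing]] := e_planar.
have [n [phi model]] := drawing_model e_sym drawing T0.
have [tp [tp_root tp_parent]] := bfs_parent (conn c).
have sep_ex (W : {set T}) : exists U : 'I_4 -> T,
    let A : pred T := fun v => [forall b, ~~ fconnect tp (U b) v] in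
    forall v, A v ->
    (2 * #|[pred w | (w \in W) && connect (restr_rel e A) v w]| <= #|W|)%N.
  have [U HU] := planar_separator tp_parent (fun w => w \in W) model.
  by exists U => A v Av; apply: leq_trans (HU v Av) _; apply: subset_leq_card.
have [sep sepP] := fin_all_exists sep_ex.
pose rho := eccentricity e c.
have rho_ge x : (gdist e c x <= rho)%N by exact: leq_bigmax.
pose L := trunc_log 2 #|T|.
have LT : (2 ^ L <= #|T|)%N by exact: trunc_logP.
have TL : (#|T| < 2 ^ L.+1)%N by exact: trunc_log_ltn.
have Lk : (4 * L.+1 <= k)%N.
  rewrite -(ler_nat R) natrM; apply: le_trans hk.
  by have := log_le_sqrt R LT; lra.
pose s := phase_strategy e c tp rho sep k.
have legal : legal_strategy e s by exact: phase_strategy_legal.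
(* Phases of length 0 are useless, but radius 0 means a single vertex, already occupied in round
   0. *)
case: (posnP rho) => [rho0|rho_gt0].
  have all_c x : x = c.
    by apply: (gdist_eq0 tp_parent); apply/eqP; rewrite -leqn0 -rho0.
  apply: (@le_trans _ _ 0%:E).
    apply: (@capt_le R T e k s 0) => // r _; exists 0%N => //.
    have k0 : (0 < k)%N by apply: leq_trans Lk.
    rewrite /captured_in; apply/orP; left; apply/existsP; exists (Ordinal k0).
    by apply/eqP; rewrite [LHS]all_c [RHS]all_c.
  by rewrite lee_fin !mulr_ge0 ?ler0n ?ln_ge0 ?ler1n.
have L0 : (0 < L)%N.
  rewrite lt0n; apply/eqP => E; rewrite E in TL.
  have /fintype_le1P all_c : (#|T| <= 1)%N by rewrite -ltnS.
  suff : (rho <= 0)%N by rewrite leqNgt rho_gt0.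
  by apply/bigmax_leqP => y _; rewrite (all_c c y) gdist_root.
apply: (@le_trans _ _ ((L.+1 * rho)%N%:R)%:E).
  apply: capt_le legal _ => r play.
  by apply: (phase_capture _ _ _ _ _ sepP Lk TL rho_gt0 play).
rewrite lee_fin natrM mulrAC; apply: ler_pM => //; first exact: log_le_ln.
by rewrite ler_nat.
Qed.
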